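(* For every integer $n\ge 2$ there exist a compact Besicovitch set $B\subset\mathbb{R}^n$ and a closed set $F\subset\mathbb{R}^n$ that contains a line in every direction such that $\dim_H B=\dim_H F$ and the following holds: if $E$ is an arbitrary subset of $\mathbb{R}^n$ and $D\subset\mathbb{RP}^{n-1}$ is a non-empty set of directions such that $E$ contains a line segment in every direction of $D$, then $$\dim_H E\ \ge\ \dim_H B-(n-1-\dim_H D).$$ In fact, a typical choice of $B$ and $F$ is good: for a typical $K\in\mathcal{K}([0,1]^n,\mathbb{RP}^{n-1})$ (in the Baire category sense), the set $B=S_1(K)$ is a compact Besicovitch set, the set $F=S_\infty(K)$ is a closed set that contains a line in every direction, $\dim_H B=\dim_H F$, and for every subset $E$ of $\mathbb{R}^n$ and every non-empty set of directions $D\subset\mathbb{RP}^{n-1}$ such that $E$ contains a line segment in every direction of $D$, we have $\dim_H E\ge\dim_H B-(n-1-\dim_H D)$.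
   Context: $\dim_H$ denotes Hausdorff dimension. Directions are elements of $\mathbb{RP}^{n-1}$, equipped with a natural metric (e.g. the angle metric). Line segments are non-degenerate. A Besicovitch set in $\mathbb{R}^n$ is a subset of $\mathbb{R}^n$ that contains a unit line segment in every direction. For non-empty compact sets $C\subset\mathbb{R}^n$ and $E\subset\mathbb{RP}^{n-1}$ let $$\mathcal{K}(C,E)=\{K\subset C\times E \text{ compact} : \mathrm{proj}_2 K=E\},$$ where $\mathrm{proj}_2$ is the projection to the second coordinate. With a natural metric on $\mathbb{R}^n\times\mathbb{RP}^{n-1}$, the set $\mathcal{K}(C,E)$ is equipped with the Hausdorff metric and is then a complete metric space. A property holds for a typical $K\in\mathcal{K}(C,E)$ if the set of those $K\in\mathcal{K}(C,E)$ that have the property is residual (i.e. contains a dense $G_\delta$ set) in $\mathcal{K}(C,E)$. For $K\in\mathcal{K}(C,E)$ and $\ell\in(0,\infty]$ let $S_\ell(K)=\bigcup_{(p,e)\in K}s(p,e,\ell)$, where for finite $\ell$, $s(p,e,\ell)$ is the closed line segment of length $\ell$ with midpoint $p$ and direction $e$, and $s(p,e,\infty)$ is the line through $p$ with direction $e$. *)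

(* Defs.v *)
From HB Require Import structures.
From mathcomp Require Import all_boot all_order all_algebra.
From mathcomp Require Import all_classical all_reals all_analysis.
From mathcomp Require Import borel_hierarchy.
From mathcomp Require Import ring lra.

Set Implicit Arguments.
Unset Strict Implicit.
Unset Printing Implicit Defensive.

Import Order.TTheory GRing.Theory Num.Theory.
Import numFieldNormedType.Exports.

Local Open Scope classical_set_scope.
Local Open Scope ring_scope.

(* The canonical norm of 'rV[R]_n is the sup norm, so the Euclidean one is
   introduced here; both induce the same topology. *)
Section Euclidean.
Context {R : realType} {n : nat}.
Implicit Types u v w : 'rV[R]_n.

Definition dot u v : R := \sum_i u 0 i * v 0 i.
Definition enorm u : R := Num.sqrt (dot u u).
Definition edist u v : R := enorm (u - v).

Lemma dotC u v : dot u v = dot v u.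
Proof. by apply: eq_bigr => i _; rewrite mulrC. Qed.

Lemma dotDl u v w : dot (u + v) w = dot u w + dot v w.
Proof. by rewrite -big_split/=; apply: eq_bigr => i _; rewrite mxE mulrDl. Qed.

Lemma dotZl a u w : dot (a *: u) w = a * dot u w.
Proof. by rewrite mulr_sumr; apply: eq_bigr => i _; rewrite mxE mulrA. Qed.

Lemma dotDr u v w : dot w (u + v) = dot w u + dot w v.
Proof. by rewrite !(dotC w) dotDl. Qed.

Lemma dotZr a u w : dot w (a *: u) = a * dot w u.
Proof. by rewrite !(dotC w) dotZl. Qed.

Lemma dotBl u v w : dot (u - v) w = dot u w - dot v w.
Proof. by rewrite -scaleN1r dotDl dotZl mulN1r. Qed.

Lemma dotBr u v w : dot w (u - v) = dot w u - dot w v.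
Proof. by rewrite !(dotC w) dotBl. Qed.

Lemma dot_ge0 u : 0 <= dot u u.
Proof. by apply: sumr_ge0 => i _; rewrite -expr2 sqr_ge0. Qed.

Lemma dot_eq0 u : dot u u = 0 -> u = 0.
Proof.
move=> /psumr_eq0P u0; apply/rowP => i; rewrite mxE.
have /eqP := u0 (fun i _ => ltac:(by rewrite -expr2 sqr_ge0)) i isT.
by rewrite mulf_eq0 orbb => /eqP.
Qed.

Lemma enorm_ge0 u : 0 <= enorm u.
Proof. exact: sqrtr_ge0. Qed.

Lemma sqr_enorm u : enorm u ^+ 2 = dot u u.
Proof. by rewrite sqr_sqrtr ?dot_ge0. Qed.

Lemma enorm_eq0 u : enorm u = 0 -> u = 0.
Proof. by move=> u0; apply: dot_eq0; rewrite -sqr_enorm u0 expr0n. Qed.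

Lemma enormZ a u : enorm (a *: u) = `|a| * enorm u.
Proof.
by rewrite /enorm dotZl dotZr mulrA -expr2 sqrtrM ?sqr_ge0// sqrtr_sqr.
Qed.

Lemma dot_CauchySchwarz u v : `|dot u v| <= enorm u * enorm v.
Proof.
rewrite -(ler_pXn2r (n := 2)) ?nnegrE ?mulr_ge0 ?enorm_ge0//.
rewrite exprMn !sqr_enorm real_normK ?num_real//.
have [v0|v0] := eqVneq (dot v v) 0.
  by rewrite (dot_eq0 v0) -(scale0r v) !dotZr mul0r expr0n/= mul0r mulr0.
have vp : 0 < dot v v by rewrite lt_neqAle eq_sym v0 dot_ge0.
have := dot_ge0 (dot v v *: u - dot u v *: v).
rewrite !(dotBl, dotBr, dotZl, dotZr) (dotC v u).
rewrite (_ : _ - _ = dot v v * (dot u u * dot v v - dot u v ^+ 2)); last by ring.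
by rewrite pmulr_rge0// subr_ge0.
Qed.

Lemma enormD u v : enorm (u + v) <= enorm u + enorm v.
Proof.
rewrite -(ler_pXn2r (n := 2)) ?nnegrE ?addr_ge0 ?enorm_ge0//.
rewrite sqrrD !sqr_enorm dotDl !dotDr (dotC v u).
have := le_trans (ler_norm _) (dot_CauchySchwarz u v); lra.
Qed.

Lemma edistxx u : edist u u = 0.
Proof. by rewrite /edist subrr -(scale0r 0) enormZ normr0 mul0r. Qed.

Lemma edist_ge0 u v : 0 <= edist u v.
Proof. exact: enorm_ge0. Qed.

Lemma edist_sym u v : edist u v = edist v u.
Proof. by rewrite /edist -opprB -scaleN1r enormZ normrN1 mul1r. Qed.

Lemma edist_triangle v u w : edist u w <= edist u v + edist v w.
Proof. by rewrite /edist -(subrKA v u (- w)) enormD. Qed.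

Lemma enorm_le u : enorm u <= Num.sqrt n%:R * `|u|.
Proof.
rewrite -(ler_pXn2r (n := 2)) ?nnegrE ?mulr_ge0 ?enorm_ge0 ?sqrtr_ge0//.
rewrite sqr_enorm exprMn sqr_sqrtr// mulr_natl.
rewrite -{2}(card_ord n) -sumr_const; apply: ler_sum => i _.
rewrite -expr2 -[leLHS]real_normK ?num_real// lerXn2r ?nnegrE//.
rewrite [leRHS]mx_normrE.
exact: (@le_bigmax _ _ _ 0 (fun ij => `|u ij.1 ij.2|) (0, i)).
Qed.

Lemma norm_le_enorm u : `|u| <= enorm u.
Proof.
rewrite [leLHS]mx_normrE; apply: bigmax_le => [|[i j] _ /=].
  exact: enorm_ge0.
rewrite -(ler_pXn2r (n := 2)) ?nnegrE ?enorm_ge0//.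
rewrite sqr_enorm real_normK ?num_real// (ord1 i) /dot (bigD1 j)//= -expr2.
by rewrite lerDl sumr_ge0// => k _; rewrite -expr2 sqr_ge0.
Qed.

End Euclidean.

(* RP^(n-1), as the set of lines through the origin of R^n, with the angle
   metric. *)
Definition direction (R : realType) (n : nat) : Type :=
  {U : {vspace 'rV[R]_n} | \dim U == 1%N}.

HB.instance Definition _ (R : realType) (n : nat) :=
  SubChoice.copy (direction R n) {U : {vspace 'rV[R]_n} | \dim U == 1%N}.

Section Direction.
Context {R : realType} {n : nat}.
Implicit Types e f g : direction R n.

Definition line_of e : {vspace 'rV[R]_n} := sval e.

(* A unit vector spanning e. *)
Definition unit_of e : 'rV[R]_n :=
  (enorm (vpick (line_of e)))^-1 *: vpick (line_of e).

Definition angle e f : R := acos `|dot (unit_of e) (unit_of f)|.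

Lemma enorm_unit_of e : enorm (unit_of e) = 1.
Proof.
rewrite enormZ ger0_norm ?invr_ge0 ?enorm_ge0// mulVf//.
apply/eqP => /enorm_eq0/eqP; rewrite vpick0 -dimv_eq0.
by rewrite (eqP (svalP e)).
Qed.

Lemma dot_unit_of e : dot (unit_of e) (unit_of e) = 1.
Proof. by rewrite -sqr_enorm enorm_unit_of expr1n. Qed.

Lemma line_ofE e : line_of e = <[unit_of e]>%VS.
Proof.
apply/esym/eqP; rewrite eqEdim; apply/andP; split.
  by rewrite -memvE memvZ// memv_pick.
rewrite (eqP (svalP e)) dim_vline lt0b.
apply/eqP => u0; have := enorm_unit_of e.
by rewrite u0 -(scale0r 0) enormZ normr0 mul0r => /eqP; rewrite eq_sym oner_eq0.
Qed.

Let absdot e f : 0 <= `|dot (unit_of e) (unit_of f)| <= 1.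
Proof.
rewrite normr_ge0/= (le_trans (dot_CauchySchwarz _ _))//.
by rewrite !enorm_unit_of mulr1.
Qed.

Let absdotN1 e f : -1 <= `|dot (unit_of e) (unit_of f)| <= 1.
Proof. by have /andP[h ->] := absdot e f; rewrite andbT; lra. Qed.

Lemma cos_angle e f : cos (angle e f) = `|dot (unit_of e) (unit_of f)|.
Proof. by rewrite /angle acosK// in_itv/= absdotN1. Qed.

Lemma angle_ge0 e f : 0 <= angle e f.
Proof. exact: acos_ge0. Qed.

Lemma angle_le_pihalf e f : angle e f <= pi / 2.
Proof.
rewrite leNgt; apply/negP => h.
have : cos (angle e f) < 0.
  rewrite -cos_pihalf ltr_cos// in_itv/= ?angle_ge0 ?acos_lepi//.
  by have := pi_gt0 R; lra.
by rewrite cos_angle ltNge normr_ge0.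
Qed.

Lemma anglexx e : angle e e = 0.
Proof. by rewrite /angle dot_unit_of normr1 acos1. Qed.

Lemma angle_sym e f : angle e f = angle f e.
Proof. by rewrite /angle dotC. Qed.

Lemma angle_eq0 e f : angle e f = 0 -> e = f.
Proof.
move=> ef0; have := cos_angle e f; rewrite ef0 cos0 => /esym d1.
set a := dot (unit_of e) (unit_of f) in d1.
have a2 : a ^+ 2 = 1 by rewrite -[LHS]real_normK ?num_real// d1 expr1n.
have uv : unit_of e = a *: unit_of f.
  have := dot_unit_of e; have := dot_unit_of f; rewrite /a in a2 *.
  move: (unit_of e) (unit_of f) a2 => u v a2 vv uu.
  apply/eqP; rewrite -subr_eq0; apply/eqP/dot_eq0.
  rewrite !(dotBl, dotBr, dotZl, dotZr) uu vv (dotC v).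
  by rewrite mulr1 -(expr2 (dot u v)) a2 !subrr mulr0 subr0.
have a0 : a != 0 by rewrite -normr_eq0 d1 oner_eq0.
apply/val_inj => /=; rewrite -!/(line_of _) !line_ofE uv.
move: (unit_of f) => u; apply/eqP; rewrite eqEsubv -!memvE memvZ ?memv_line//=.
by have := memvZ a^-1 (memv_line (a *: u)); rewrite scalerK.
Qed.

Lemma angle_triangle f e g : angle e g <= angle e f + angle f g.
Proof.
have abpi : angle e f + angle f g <= pi.
  by have := angle_le_pihalf e f; have := angle_le_pihalf f g; lra.
rewrite leNgt -ltr_cos ?in_itv/= ?angle_ge0 ?acos_lepi ?abpi ?addr_ge0 ?angle_ge0//.
rewrite -leNgt cosD !cos_angle /angle !sin_acos//.
have := dot_unit_of e; have := dot_unit_of f; have := dot_unit_of g.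
move: (unit_of e) (unit_of f) (unit_of g) => u v w ww vv uu.
have := dot_CauchySchwarz (u - dot u v *: v) (w - dot v w *: v).
rewrite /enorm !(dotBl, dotBr, dotZl, dotZr) uu vv ww.
rewrite !real_normK ?num_real// (dotC v u) (dotC w v).
rewrite (_ : _ - _ - _ = dot u w - dot u v * dot v w); last by ring.
rewrite (_ : 1 - _ - _ = 1 - dot u v ^+ 2); last by ring.
rewrite (_ : 1 - _ - _ = 1 - dot v w ^+ 2); last by ring.
rewrite -normrM => h.
have := ler_normB (dot u w) (dot u w - dot u v * dot v w).
rewrite opprB addrC subrK; lra.
Qed.

HB.instance Definition _ := isMetric.Build R (direction R n)
  anglexx angle_eq0 angle_sym angle_triangle.

End Direction.

(* Hausdorff dimension of the subsets of a set T with a distance d. *)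
Section HausdorffDimension.
Context {R : realType} {T : Type} (d : T -> T -> R).
Local Open Scope ereal_scope.

Definition diam (U : set T) : \bar R :=
  ereal_sup [set (d x.1 x.2)%:E | x in U `*` U].

(* The s-th power of the diameter; the empty set has weight 0, even when
   s = 0, and a singleton has weight 0 `^ 0 = 1 when s = 0. *)
Definition hweight (s : R) (U : set T) : \bar R :=
  if U == set0 then 0 else diam U `^ s.

Definition hausdorff_content (s delta : R) (A : set T) : \bar R :=
  ereal_inf [set \sum_(0 <= i <oo) hweight s (U i) | U in
    [set U : (set T)^nat |
      A `<=` \bigcup_i U i /\ forall i, diam (U i) <= delta%:E]].

Definition hausdorff_measure (s : R) (A : set T) : \bar R :=
  ereal_sup [set hausdorff_content s delta A |
    delta in [set delta | (0 < delta)%R]].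

Definition hausdorff_dim (A : set T) : \bar R :=
  ereal_inf [set s%:E | s in
    [set s : R | (0 <= s)%R /\ hausdorff_measure s A = 0]].

End HausdorffDimension.

Definition dimH {R : realType} {n : nat} (A : set 'rV[R]_n) : \bar R :=
  hausdorff_dim edist A.

Definition dimH_dir {R : realType} {n : nat} (D : set (direction R n)) : \bar R :=
  hausdorff_dim angle D.

(* The segment s(p, e, l); it is a line when l = +oo. *)
Definition segment {R : realType} {n : nat} (p : 'rV[R]_n) (e : direction R n)
    (l : \bar R) : set 'rV[R]_n :=
  [set x | x - p \in line_of e /\ ((enorm (x - p))%:E <= l * 2^-1%:E)%E].

Lemma segment_fin (R : realType) (n : nat) (p : 'rV[R]_n)
    (e : direction R n) (l : R) :
  segment p e l%:E = [set p + t *: unit_of e | t in [set t | `|t| <= l / 2]].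
Proof.
apply/seteqP; split=> [x [xe]|_ [t tl <-]].
  rewrite -EFinM lee_fin => xl; rewrite line_ofE in xe.
  have /vlineP[t xt] := xe; exists t; last by rewrite -xt addrC subrK.
  by move: xl; rewrite xt enormZ enorm_unit_of mulr1.
split; rewrite /= (addrC p) addrK; first by rewrite line_ofE memvZ// memv_line.
by rewrite -EFinM lee_fin enormZ enorm_unit_of mulr1.
Qed.

Lemma segment_pinfty (R : realType) (n : nat) (p : 'rV[R]_n)
    (e : direction R n) :
  segment p e +oo = [set p + t *: unit_of e | t in [set: R]].
Proof.
apply/seteqP; split=> [x [+ _]|_ [t _ <-]].
  by rewrite line_ofE => /vlineP[t xt]; exists t; rewrite // -xt addrC subrK.
split; rewrite /= (addrC p) addrK; first by rewrite line_ofE memvZ// memv_line.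
by rewrite gt0_mulye ?lte_fin ?invr_gt0// leey.
Qed.

(* The set S_l(K). *)
Definition segments {R : realType} {n : nat} (l : \bar R)
    (K : set ('rV[R]_n * direction R n)) : set 'rV[R]_n :=
  \bigcup_(pe in K) segment pe.1 pe.2 l.

Definition besicovitch {R : realType} {n : nat} (B : set 'rV[R]_n) :=
  forall e : direction R n, exists p, segment p e 1%E `<=` B.

Definition line_in_every_direction {R : realType} {n : nat}
    (F : set 'rV[R]_n) :=
  forall e : direction R n, exists p, segment p e +oo%E `<=` F.

Definition segment_in_directions {R : realType} {n : nat}
    (D : set (direction R n)) (E : set 'rV[R]_n) :=
  forall e, D e ->
    exists p (l : R), 0 < l /\ segment p e l%:E `<=` E.

Definition unit_cube {R : realType} {n : nat} : set 'rV[R]_n :=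
  [set x | forall i, 0 <= x 0 i <= 1].

Definition residual {T : topologicalType} (A : set T) :=
  exists G : set T, [/\ Gdelta G, dense G & G `<=` A].

(* K(C, E) as a set of sets; Kspace C E below is the corresponding type, with
   the Hausdorff metric. *)
Definition Kset {R : realType} {n : nat} (C : set 'rV[R]_n)
    (E : set (direction R n)) : set (set ('rV[R]_n * direction R n)) :=
  [set K | [/\ K `<=` C `*` E, compact K & snd @` K = E]].

Definition Kspace {R : realType} {n : nat} (C : set 'rV[R]_n)
    (E : set (direction R n)) : Type := set_type (Kset C E).

HB.instance Definition _ (R : realType) (n : nat) (C : set 'rV[R]_n)
  (E : set (direction R n)) := SubChoice.copy (Kspace C E) (set_type (Kset C E)).

Section HausdorffMetric.
Context {R : realType} {n : nat}.
Local Notation X := ('rV[R]_n * direction R n)%type.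
Implicit Types (x y z : X) (K L M : set X).

(* The max of the two distances is the metric used on R^n x RP^(n-1). *)
Definition pdist x y : R := Num.max (edist x.1 y.1) (angle x.2 y.2).

(* The smallest r such that K and L are contained in the closed
   r-neighbourhoods of each other. *)
Definition hausdorff_dist K L : R :=
  inf [set r : R | [/\ 0 <= r,
    (forall x, K x -> exists2 y, L y & pdist x y <= r) &
    (forall y, L y -> exists2 x, K x & pdist x y <= r)]].

Lemma pdistxx x : pdist x x = 0.
Proof. by rewrite /pdist edistxx anglexx maxxx. Qed.

Lemma pdist_sym x y : pdist x y = pdist y x.
Proof. by rewrite /pdist edist_sym angle_sym. Qed.

Lemma pdist_ge0 x y : 0 <= pdist x y.
Proof. by rewrite /pdist le_max edist_ge0. Qed.

Lemma pdist_triangle y x z : pdist x z <= pdist x y + pdist y z.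
Proof.
rewrite {1}/pdist ge_max; apply/andP; split.
  by rewrite (le_trans (edist_triangle y.1 _ _))// lerD// le_max lexx.
by rewrite (le_trans (angle_triangle y.2 _ _))// lerD// le_max lexx orbT.
Qed.

Lemma pdist_ball x y (r : R) : pdist x y < r -> ball x r y.
Proof.
rewrite /pdist gt_max => /andP[xy1 xy2]; split; last by rewrite ballEmdist.
by rewrite -ball_normE/=; apply: le_lt_trans xy1; exact: norm_le_enorm.
Qed.

Lemma hausdorff_X : hausdorff_space X.
Proof.
move=> [p e] [q f] pq; congr pair.
  apply: norm_hausdorff => A B pA qB.
  have [[x g] [/= Ax Bx]] := pq (fst @^-1` A) (fst @^-1` B)
    (cvg_fst pA) (cvg_fst qB).
  by exists x.
apply: metric_hausdorff => A B pA qB.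
have [[x g] [/= Ax Bx]] := pq (snd @^-1` A) (snd @^-1` B)
  (cvg_snd pA) (cvg_snd qB).
by exists g.
Qed.

Lemma compact_pdist_mem K x : compact K ->
  (forall r, 0 < r -> exists2 y, K y & pdist x y < r) -> K x.
Proof.
move=> /(compact_closed hausdorff_X) cK h; apply: cK => A.
rewrite -nbhs_ballE => -[r /= r0 rA].
by have [y Ky /pdist_ball xy] := h r r0; exists y; split=> //; exact: rA.
Qed.

Lemma compact_pdist_bound K L : compact K -> compact L ->
  exists2 r, 0 <= r & forall x y, K x -> L y -> pdist x y <= r.
Proof.
have bnd M : compact M ->
    exists2 r, 0 <= r & forall x, M x -> enorm x.1 <= r.
  move=> cM; have /compact_bounded[r [_ rM]] : compact (fst @` M).
    apply: continuous_compact => //; apply: continuous_subspaceT => x.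
    exact: cvg_fst.
  exists (Num.sqrt n%:R * (`|r| + 1)); first by rewrite mulr_ge0 ?sqrtr_ge0.
  move=> x Mx; rewrite (le_trans (enorm_le _))// ler_wpM2l ?sqrtr_ge0//.
  by apply: rM; [rewrite (le_lt_trans (ler_norm _))// ltrDl|exists x].
move=> /bnd[r r0 rK] /bnd[s s0 sL].
exists (r + s + pi); first by have := pi_ge0 R; lra.
move=> x y Kx Ly; rewrite /pdist ge_max; apply/andP; split.
  rewrite (le_trans (enormD _ _))// -scaleN1r enormZ normrN1 mul1r.
  by have := rK _ Kx; have := sL _ Ly; have := pi_ge0 R; lra.
by have := angle_le_pihalf x.2 y.2; have := pi_ge0 R; lra.
Qed.

Lemma hausdorff_dist_le K L (r : R) : 0 <= r ->
  (forall x, K x -> exists2 y, L y & pdist x y <= r) ->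
  (forall y, L y -> exists2 x, K x & pdist x y <= r) ->
  hausdorff_dist K L <= r.
Proof.
by move=> r0 KL LK; apply: ge_inf; [exists 0 => s []|].
Qed.

Lemma hausdorff_distxx K : hausdorff_dist K K = 0.
Proof.
apply/eqP; rewrite eq_le; apply/andP; split.
  by apply: hausdorff_dist_le => // x Kx; exists x; rewrite ?pdistxx.
apply: lb_le_inf => [|s []//].
by exists 0; split=> // x Kx; exists x; rewrite ?pdistxx.
Qed.

Lemma hausdorff_dist_sym K L : hausdorff_dist K L = hausdorff_dist L K.
Proof.
congr inf; apply/seteqP; split=> r [r0 h1 h2]; split=> // x.
- by move=> /h2[y]; exists y; rewrite // pdist_sym.
- by move=> /h1[y]; exists y; rewrite // pdist_sym.
- by move=> /h2[y]; exists y; rewrite // pdist_sym.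
- by move=> /h1[y]; exists y; rewrite // pdist_sym.
Qed.

Lemma hausdorff_dist_lt K L (r : R) : compact K -> compact L ->
  (K = set0 <-> L = set0) -> hausdorff_dist K L < r ->
  exists s, [/\ 0 <= s, s < r,
    (forall x, K x -> exists2 y, L y & pdist x y <= s) &
    (forall y, L y -> exists2 x, K x & pdist x y <= s)].
Proof.
move=> cK cL KL0 KLr.
have hi : has_inf [set r : R | [/\ 0 <= r,
    (forall x, K x -> exists2 y, L y & pdist x y <= r) &
    (forall y, L y -> exists2 x, K x & pdist x y <= r)]].
  split; last by exists 0 => s [].
  have [s s0 sKL] := compact_pdist_bound cK cL.
  exists s; split=> // x Kx.
  - have /set0P[y Ly] : L != set0.
      by apply/eqP => /KL0 K0; rewrite K0 in Kx.
    by exists y => //; exact: sKL.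
  - have /set0P[y Ly] : K != set0.
      by apply/eqP => /KL0 K0; rewrite K0 in Kx.
    by exists y => //; exact: sKL.
have e0 : 0 < r - hausdorff_dist K L by rewrite subr_gt0.
have [s [s0 h1 h2] sr] := inf_adherent e0 hi.
by exists s; split=> //; move: sr; rewrite -/(hausdorff_dist K L) addrC subrK.
Qed.

Section instance.
Variables (C : set 'rV[R]_n) (E : set (direction R n)).

Definition Kdist (K L : Kspace C E) : R := hausdorff_dist (\val K) (\val L).

Let Kcompact (K : Kspace C E) : compact (\val K).
Proof. by have [] := set_mem (valP K). Qed.

Let Kset0 (K L : Kspace C E) : \val K = set0 <-> \val L = set0.
Proof.
have [_ _ KE] := set_mem (valP K); have [_ _ LE] := set_mem (valP L).
split=> h0; apply: (@image_set0_set0 _ _ _ snd).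
  by rewrite LE -KE h0 image_set0.
by rewrite KE -LE h0 image_set0.
Qed.

Lemma Kdist_lt (K L : Kspace C E) (r : R) : Kdist K L < r ->
  exists s, [/\ 0 <= s, s < r,
    (forall x, \val K x -> exists2 y, \val L y & pdist x y <= s) &
    (forall y, \val L y -> exists2 x, \val K x & pdist x y <= s)].
Proof. exact: hausdorff_dist_lt. Qed.

Let Kdistxx (K : Kspace C E) : Kdist K K = 0.
Proof. exact: hausdorff_distxx. Qed.

Let Kdist_sym (K L : Kspace C E) : Kdist K L = Kdist L K.
Proof. exact: hausdorff_dist_sym. Qed.

Let Kdist_eq0 (K L : Kspace C E) : Kdist K L = 0 -> K = L.
Proof.
have sub (K' L' : Kspace C E) : Kdist K' L' = 0 -> \val K' `<=` \val L'.
  move=> d0 x Kx; apply: compact_pdist_mem => // r r0.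
  have [|s [_ sr h _]] := @Kdist_lt K' L' r; first by rewrite d0.
  by have [y Ly xy] := h x Kx; exists y => //; exact: le_lt_trans xy sr.
move=> d0; apply/val_inj/seteqP; split; first exact: sub.
by apply: sub; rewrite Kdist_sym.
Qed.

Let Kdist_triangle (L K M : Kspace C E) : Kdist K M <= Kdist K L + Kdist L M.
Proof.
apply/ler_addgt0Pl => e e0.
have e20 : 0 < e / 2 by rewrite divr_gt0.
have [|r [r0 rlt KL LK]] := @Kdist_lt K L (Kdist K L + e / 2); first lra.
have [|s [s0 slt LM ML]] := @Kdist_lt L M (Kdist L M + e / 2); first lra.
apply: (@le_trans _ _ (r + s)); last lra.
apply: hausdorff_dist_le; first exact: addr_ge0.
  move=> x /KL[y /LM[z Mz yz] xy]; exists z => //.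
  by rewrite (le_trans (pdist_triangle y _ _))// lerD.
move=> z /ML[y /LK[x Kx xy] yz]; exists x => //.
by rewrite (le_trans (pdist_triangle y _ _))// lerD.
Qed.

HB.instance Definition _ := isMetric.Build R (Kspace C E)
  Kdistxx Kdist_eq0 Kdist_sym Kdist_triangle.

End instance.
End HausdorffMetric.

(* Main.v *)
From HB Require Import structures.
From mathcomp Require Import all_boot all_order all_algebra.
From mathcomp Require Import all_classical all_reals all_analysis.
From mathcomp Require Import ring lra.
Require Import Defs.

(** Write d = n - 1.  Say that sigma is achievable when sigma > s + d - u for
    some set E that is null for the s-dimensional Hausdorff measure and
    contains a segment in every direction of a set D that is not null for the
    u-dimensional one.  Let critical be the infimum of the achievable numbers.
    The inequality of the theorem says exactly that dim B is at most critical;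
    so the point is that a typical K makes the set F of lines, which contains
    B, as small as any test pair (E, D) allows: F is sigma-null for every
    sigma > critical.  Conversely B and F contain segments in all directions,
    which makes each of them a test set with D everything and u = d, so both
    have dimension at least critical ([generic_conclusion]).

    The uncountably many pairs (E, D) are handled by choosing a sequence of
    achievable numbers that tends to critical.  Being covered by a family of
    balls of small sigma-cost is an open condition on a compact union of
    segments; hence, by the Baire property of the space of compact sets
    ([Kspace_baire]), it suffices to show that it is dense ([dense_stage]).
    For this it is enough to produce, from one test pair, an open set of
    arbitrarily small sigma-cost that contains a long segment in every
    direction with midpoint near the origin ([thick_segments]); finitely many
    translates of such a set then surround a finite net of a given K.

    To produce it, cover E by balls of small s-cost and let U be their union.
    In a chart of projective space the directions x of the segments in U form
    an open set G that contains D, and a shear of R^n acts on the chart as a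
    translation.  Scaling makes segments longer.  So one looks for a finite
    set C of translations such that G + C contains the whole chart, and takes
    the union of the sheared copies of U.  Its cost stays under control if C
    has at most m K^j approximate positions at the scale M^-j, where K is
    about M^(d - u) and m does not depend on U: a ball of radius r is then
    replaced by about r^(u - d) balls of a comparable radius, which turns
    s-cost into (s + d - u)-cost ([spread_lines]).

    Such a set C is found by a random construction ([few_translations]).  The
    u-dimensional content of G is at least that of D, hence bounded below
    independently of U, and by an exhaustion property of net contents
    ([net_content]) a definite part of it is carried by the M-adic cubes of
    some finite level J contained in G.  Starting from m copies of the trivial
    translation, each translation of level j is replaced by K random
    refinements of level j + 1.  For a grid point y of level j the survival is
    a product which bounds the probability that no translation brings y into
    the cubes that still carry content.  One refinement squares the survival
    on average, whereas the number of grid points only grows by the factor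
    M^d; so if the sum of the survivals is at most M^-d at the beginning, this
    remains true up to level J ([survival_step]), and every point is reached. *)

Set Implicit Arguments.
Unset Strict Implicit.
Unset Printing Implicit Defensive.

Import Order.TTheory GRing.Theory Num.Theory.
Import numFieldNormedType.Exports.

Local Open Scope classical_set_scope.
Local Open Scope ring_scope.

(** * Choosing translations by averaging *)

Section Averaging.
Context {R : realType}.

(** Expanding the products on the right turns them into the mean of the left-hand
    side over all functions f, and some f does not exceed the mean.  This is how
    independent random choices are made below. *)
Lemma exists_choice_le_average (T : Type) (ts : seq T) (I B : finType)
    (F : T -> I -> B -> R) : (0 < #|B|)%N ->
  exists f : I -> B, \sum_(t <- ts) \prod_i F t i (f i) <=
    \sum_(t <- ts) \prod_i ((\sum_b F t i b) / #|B|%:R).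
Proof.
move=> B0; apply: contrapT => /forallNP hn.
set S := \sum_(t <- ts) _ in hn.
have {}hn (f : {ffun I -> B}) : S < \sum_(t <- ts) \prod_i F t i (f i).
  by rewrite ltNge; apply/negP; exact: hn.
have /card_gt0P[b0 _] := B0.
have N0 : (0 < #|{ffun I -> B}|)%N by apply/card_gt0P; exists [ffun=> b0].
have : \sum_(f : {ffun I -> B}) S <
    \sum_(f : {ffun I -> B}) \sum_(t <- ts) \prod_i F t i (f i).
  by apply: ltr_sum => //; apply/hasP; exists [ffun=> b0]; rewrite ?mem_index_enum.
rewrite [ltRHS]exchange_big/= sumr_const.
rewrite ltNge => /negP; apply.
rewrite -mulr_natl mulr_sumr; apply: ler_sum => t _.
rewrite -bigA_distr_bigA/= big_split/= prodr_const -mulr_natl.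
rewrite exprVn mulrCA card_ffun natrX mulr1.
rewrite (_ : _ / _ = 1) ?mulr1//; apply: divff.
by rewrite expf_eq0 pnatr_eq0 (gtn_eqF B0) andbF.
Qed.

(** Both sides are compared with exp (- 4 t): a failure of probability 1 - p
    repeated K times is at most exp (- K p), and 1 - t >= exp (- 2 t) up to
    t = 1 / 2.  The square on the right is what drives [survival_step]. *)
Lemma exp_ratio_le_sqr (t p : R) K : 0 <= t <= 2^-1 -> p <= 1 ->
  4 * t <= K%:R * p -> (1 - p) ^+ K <= (1 - t) ^+ 2.
Proof.
move=> /andP[t0 t2] p1 tp.
apply: (@le_trans _ _ (expR (- (4 * t)))).
  apply: (@le_trans _ _ (expR (- p) ^+ K)).
    rewrite lerXn2r ?nnegrE ?expR_ge0 ?subr_ge0//.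
    by have := expR_ge1Dx (- p).
  by rewrite -expRM_natl ler_expR mulrN lerN2.
rewrite (_ : - (4 * t) = 2%:R * - (2 * t)); last by ring.
rewrite expRM_natl lerXn2r ?nnegrE ?expR_ge0//; first by lra.
rewrite expRN invf_ple ?posrE ?expR_gt0//; last by lra.
apply: le_trans (expR_ge1Dx (2 * t)).
rewrite -[leLHS]mul1r ler_pdivrMr; last by lra.
nra.
Qed.

End Averaging.

Section Selection.
Context {R : realType} {d M' : nat}.
Local Notation V := 'rV[R]_d.
Local Notation M := (M'.+1%:R : R).
Local Notation digits := {ffun 'I_d -> 'I_M'.+1}.
Local Notation shifts := {ffun 'I_d -> 'I_(M'.*2.+1)}.
Implicit Types (C Y : seq V) (a : digits) (b : shifts) (h : nat -> V -> R).

Definition mesh (j : nat) : R := M ^- j.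

Definition digit_vec a : V := \row_i (a i)%:R.

(** Translations are written with signed digits, so that digit_vec a - shift_vec b
    can be any digit vector and no carry ever occurs. *)
Definition shift_vec b : V := \row_i ((b i)%:R - M'%:R).

(** The lower corners of the M-adic cubes of level j in the unit cube. *)
Definition grid j : seq V := iteri j (fun i Y =>
  [seq t.1 + mesh i.+1 *: digit_vec t.2 |
    t <- [seq (y, a) | y <- Y, a <- enum {: digits}]]) [:: 0].

Lemma gridS j : grid j.+1 = [seq t.1 + mesh j.+1 *: digit_vec t.2 |
  t <- [seq (y, a) | y <- grid j, a <- enum {: digits}]].
Proof. by []. Qed.

Lemma mesh_gt0 j : 0 < mesh j.
Proof. by rewrite invr_gt0 exprn_gt0. Qed.

Lemma mesh0 : mesh 0 = 1.
Proof. by rewrite /mesh expr0 invr1. Qed.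

Lemma meshS j : M * mesh j.+1 = mesh j.
Proof. by rewrite /mesh exprS invfM mulrA mulfV ?mul1r ?pnatr_eq0. Qed.

(** With h j z between 0 and 1 measuring how much of the target lies in the cube of
    level j at z, this bounds the probability that random refinements of the
    translations in C fail to bring the cube at y into the target. *)
Definition survival h j C (y : V) : R := \prod_(c <- C) (1 - h j (y - c) / 2).

(** The digit vector a' is the difference of a and of the shift a - a', and
    distinct a' have distinct shifts. *)
Lemma sum_shifts_ge (g : V -> R) (a : digits) : (forall z, 0 <= g z) ->
  \sum_a' g (digit_vec a') <= \sum_b g (digit_vec a - shift_vec b).
Proof.
move=> g0.
(* The shift a - a', with its digits moved by M' into the range of shifts. *)
pose s (a' : digits) : shifts := [ffun i => inord (a i + (M' - a' i))].
have sE a' i : s a' i = (a i + (M' - a' i))%N :> nat.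
  rewrite ffunE inordK// ltnS -addnn leq_add ?leq_subr//.
  by rewrite -ltnS ltn_ord.
have sv a' : digit_vec a - shift_vec (s a') = digit_vec a'.
  apply/rowP => i; rewrite !mxE sE natrD natrB; first by ring.
  by rewrite -ltnS ltn_ord.
have s_inj : injective s.
  move=> a1 a2 s12; have := sv a1; rewrite s12 sv => /rowP e.
  apply/ffunP => i; apply/val_inj/eqP; have := e i; rewrite !mxE.
  by move/eqP; rewrite eqr_nat eq_sym.
rewrite (eq_bigr (fun a' => g (digit_vec a - shift_vec (s a')))); last first.
  by move=> a' _; rewrite sv.
rewrite -(big_imset (A := mem predT) (fun b => g (digit_vec a - shift_vec b)) (in2W s_inj))/=.
rewrite [leRHS](bigID (mem (imset s (mem predT))))/= lerDl.
by apply: sumr_ge0.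
Qed.

Section step.
Variables (h : nat -> V -> R) (kappa : R) (K : nat).
Hypothesis h01 : forall j z, 0 <= h j z <= 1.
Hypothesis hsub : forall j z,
  h j z <= kappa * \sum_a h j.+1 (z + mesh j.+1 *: digit_vec a).
Hypothesis Kbig : 4 * kappa * (M'.*2.+1 ^ d)%:R <= K%:R.

Local Notation N := (#|{: digits}|%:R : R).

Lemma survival_ge0 j C y : 0 <= survival h j C y.
Proof.
apply: prodr_ge0 => c _; have /andP[] := h01 j (y - c).
by rewrite subr_ge0; lra.
Qed.

(** By [hsub] and [sum_shifts_ge], the mean over one random refinement is at most
    1 - p with p >= h j z / (2 kappa (2 M' + 1)^d); by [Kbig], K of them are
    enough to apply [exp_ratio_le_sqr]. *)
Lemma survival_average j (a : digits) (z : V) :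
  ((\sum_b (1 - h j.+1 (z + mesh j.+1 *: (digit_vec a - shift_vec b)) / 2))
    / #|{: shifts}|%:R) ^+ K <= (1 - h j z / 2) ^+ 2.
Proof.
have B0 : 0 < (#|{: shifts}|%:R : R).
  by rewrite ltr0n; apply/card_gt0P; exists [ffun=> ord0].
set S := \sum_a h j.+1 (z + mesh j.+1 *: digit_vec a).
pose g v := h j.+1 (z + mesh j.+1 *: v).
have Sle : S <= \sum_b g (digit_vec a - shift_vec b).
  by apply: sum_shifts_ge => v; have /andP[] := h01 j.+1 (z + mesh j.+1 *: v).
pose p := (\sum_b g (digit_vec a - shift_vec b)) / 2 / #|{: shifts}|%:R.
rewrite sumrB sumr_const -mulr_suml mulrBl divff ?gt_eqF// -/(g _) -/p.
have p1 : p <= 1.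
  rewrite ler_pdivrMr// mul1r ler_pdivrMr//.
  apply: (@le_trans _ _ (\sum_b (1:R))).
    by apply: ler_sum => b _; have /andP[] := h01 j.+1 (z + mesh j.+1 *: (digit_vec a - shift_vec b)).
  by rewrite sumr_const ler_peMr// ?ler1n.
have /andP[h0 h1] := h01 j z.
apply: exp_ratio_le_sqr => //; first by lra.
apply: (@le_trans _ _ (K%:R * (S / 2 / #|{: shifts}|%:R))); last first.
  apply: ler_wpM2l => //; apply: ler_wpM2r; first by rewrite invr_ge0 ltW.
  by apply: ler_wpM2r => //; rewrite invr_ge0.
have S0 : 0 <= S.
  by apply: sumr_ge0 => a' _; have /andP[] := h01 j.+1 (z + mesh j.+1 *: digit_vec a').
apply: (@le_trans _ _ (4 * kappa * (M'.*2.+1 ^ d)%:R * (S / 2 / #|{: shifts}|%:R))); last first.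
  by rewrite ler_wpM2r// !divr_ge0.
rewrite card_ffun !card_ord in B0 *.
rewrite [leRHS](_ : _ = 4 * (kappa * S / 2)); last first.
  by move: (_ ^ _)%:R B0 => w w0; field; rewrite gt_eqF.
by rewrite ler_pM2l// ler_pM2r ?invr_gt0//; exact: hsub.
Qed.

(** One random refinement squares each survival on average.  A survival is at most
    the sum of all of them, hence at most 1 / N, and this extra factor makes up
    for the N times larger number of grid points. *)
Lemma survival_step j C : \sum_(y <- grid j) survival h j C y <= N^-1 ->
  exists C', [/\ size C' = (size C * K)%N,
    \sum_(y <- grid j.+1) survival h j.+1 C' y <= N^-1 &
    forall c', c' \in C' -> exists2 c, c \in C &
      exists b : shifts, c' = c + mesh j.+1 *: shift_vec b].
Proof.
move=> CN.
pose I := ('I_(size C) * 'I_K)%type.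
pose co (i : I) : V := nth 0 C i.1.
pose ts := [seq (y, a) | y <- grid j, a <- enum {: digits}].
pose F (t : V * digits) (i : I) b : R :=
  1 - h j.+1 ((t.1 - co i) + mesh j.+1 *: (digit_vec t.2 - shift_vec b)) / 2.
have B0 : (0 < #|{: shifts}|)%N by apply/card_gt0P; exists [ffun=> ord0].
have N0 : 0 < N by rewrite ltr0n; apply/card_gt0P; exists [ffun=> ord0].
have [f fle] := exists_choice_le_average ts F B0.
pose C' := [seq co i + mesh j.+1 *: shift_vec (f i) | i <- enum {: I}].
exists C'; split.
- by rewrite size_map -cardT card_prod !card_ord.
- rewrite gridS big_map.
  apply: (@le_trans _ _ (\sum_(t <- ts) \prod_i F t i (f i))).
    apply: ler_sum => -[y a] _ /=; rewrite le_eqVlt; apply/orP; left; apply/eqP.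
    rewrite /survival big_map big_enum/=; apply: eq_bigr => i _.
    rewrite /F/= scalerBr; congr (1 - h _ _ / 2).
    by rewrite opprD addrACA.
  apply: (le_trans fle); rewrite big_allpairs.
  apply: (@le_trans _ _ (\sum_(y <- grid j) \sum_(a <- enum {: digits})
      survival h j C y ^+ 2)).
    apply: ler_sum => y _; apply: ler_sum => a _.
    rewrite (eq_bigr (fun i : I => (fun k : 'I_(size C) => (fun _ : 'I_K =>
      (\sum_b F (y, a) (k, i.2) b) / #|{: shifts}|%:R)) i.1 i.2)); last by case.
    rewrite -(pair_bigA _ (fun (k : 'I_(size C)) (l : 'I_K) =>
      (\sum_b F (y, a) (k, l) b) / #|{: shifts}|%:R))/=.
    rewrite /survival (big_nth 0) big_mkord expr2 -big_split/=.
    apply: ler_prod => k _.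
    rewrite (eq_bigr (fun _ : 'I_K => (\sum_b
       (1 - h j.+1 ((y - C`_k) + mesh j.+1 *: (digit_vec a - shift_vec b)) / 2))
         / #|{: shifts}|%:R)); last by [].
    rewrite prodr_const card_ord -expr2 survival_average andbT.
    apply: exprn_ge0; apply: divr_ge0 => //; apply: sumr_ge0 => b _.
    have /andP[] := h01 j.+1 (y - C`_k + mesh j.+1 *: (digit_vec a - shift_vec b)).
    by rewrite subr_ge0; lra.
  apply: le_trans (CN); rewrite big_seq [leRHS]big_seq.
  apply: ler_sum => y yj; rewrite big_const_seq count_predT -cardT iter_addr_0.
  rewrite -mulr_natr expr2 -mulrA ler_piMr ?survival_ge0//.
  rewrite -ler_pdivlMr// mul1r (le_trans _ CN)//.
  rewrite (big_rem y)//= lerDl; apply: sumr_ge0 => z _; exact: survival_ge0.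
- move=> c' /mapP[i _ ->]; exists (co i); last by exists (f i).
  exact: mem_nth.
Qed.

End step.
End Selection.

(** * Covers by balls and their cost *)

Section SupNorm.
Context {R : realType} {k : nat}.
Implicit Types x y : 'rV[R]_k.

Lemma coord_le_norm x i : `|x 0 i| <= `|x|.
Proof.
rewrite [leRHS]mx_normrE.
exact: (@le_bigmax _ _ _ 0 (fun ij => `|x ij.1 ij.2|) (0, i)).
Qed.

Lemma norm_le_coord x (e : R) : 0 <= e -> (forall i, `|x 0 i| <= e) -> `|x| <= e.
Proof.
move=> e0 xe; rewrite [leLHS]mx_normrE; apply: bigmax_le => // -[i j] _ /=.
by rewrite (ord1 i).
Qed.

Lemma norm_lt_coord x (e : R) : 0 < e -> (forall i, `|x 0 i| < e) -> `|x| < e.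
Proof.
move=> e0 xe; rewrite [ltLHS]mx_normrE; apply: bigmax_lt => // -[i j] _ /=.
by rewrite (ord1 i).
Qed.

End SupNorm.

Section Covers.
Context {R : realType} {k : nat}.
Local Notation V := 'rV[R]_k.
Implicit Types (A B : set V) (F : nat -> seq (V * R)) (u e : R).

Definition covered F : set V :=
  [set x | exists l, exists2 b, b \in F l & `|x - b.1| < b.2].

Definition weight u (s : seq (V * R)) : R := \sum_(b <- s) b.2 `^ u.

(** Having a finite list for each index, instead of one ball, allows empty families
    and several balls per index without padding; padding would have a cost when
    u = 0. *)
Definition economical u e F :=
  (forall l b, b \in F l -> 0 < b.2) /\
  forall L, \sum_(l < L) weight u (F l) <= e.

(** The sets of zero u-dimensional Hausdorff measure, see [null_of_dimH_lt] and
    [null_hausdorff_measure]. *)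
Definition null u A := forall e, 0 < e ->
  exists2 F, economical u e F & A `<=` covered F.

Lemma weight_ge0 u s : 0 <= weight u s.
Proof. by apply: sumr_ge0 => b _; exact: powR_ge0. Qed.

Lemma weight_cat u s1 s2 : weight u (s1 ++ s2) = weight u s1 + weight u s2.
Proof. exact: big_cat. Qed.

End Covers.

Lemma cvg_sum_seq (R : realType) (I : Type) (r : seq I) (f : I -> nat -> R)
    (l : I -> R) : (forall i, f i k @[k --> \oo] --> l i) ->
  (\sum_(i <- r) f i k) @[k --> \oo] --> \sum_(i <- r) l i.
Proof.
move=> fl; elim: r => [|i r IH].
  rewrite big_nil; under eq_fun do rewrite big_nil; exact: cvg_cst.
rewrite big_cons; under eq_fun do rewrite big_cons; exact: cvgD.
Qed.

(** * Net content, exhausted from inside *)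

Section Content.
Context {R : realType} {d M' : nat}.
Local Notation V := 'rV[R]_d.
Local Notation M := (M'.+1%:R : R).
Local Notation digits := {ffun 'I_d -> 'I_M'.+1}.
Local Notation mesh := (@mesh R M').
Local Notation digit_vec := (@digit_vec R d M').
Local Notation grid := (@grid R d M').
Implicit Types (a : digits) (x y z : V).

Definition cube j z : set V :=
  [set x | forall i, z 0 i <= x 0 i < z 0 i + mesh j].

Definition child j z a : V := z + mesh j.+1 *: digit_vec a.

Lemma cube_child j z x : cube j z x -> exists a, cube j.+1 (child j z a) x.
Proof.
move=> zx; pose t i := (x 0 i - z 0 i) / mesh j.+1.
have m0 := @mesh_gt0 R M' j.+1.
have t0 i : 0 <= t i.
  by rewrite divr_ge0 ?(ltW m0)// subr_ge0; have /andP[] := zx i.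
have tM i : (Num.truncn (t i) < M'.+1)%N.
  rewrite truncn_lt_nat// ltr_pdivrMr// meshS.
  by have /andP[_] := zx i; rewrite ltrBlDl.
exists [ffun i => Ordinal (tM i)] => i; rewrite /child !mxE ffunE/=.
have /andP[] := truncn_itv (t0 i).
rewrite ler_pdivlMr// ltr_pdivrMr// -natr1 mulrDl mul1r => h1 h2.
by rewrite -lerBrDl (mulrC (mesh _)) h1/= -addrA -ltrBlDl.
Qed.

Lemma sub_cube_child j z a : cube j.+1 (child j z a) `<=` cube j z.
Proof.
move=> x xc i; have /andP[] := xc i; rewrite /child !mxE => h1 h2.
have m0 := @mesh_gt0 R M' j.+1.
rewrite (le_trans _ h1) ?lerDl ?mulr_ge0 ?(ltW m0)//=.
rewrite (lt_le_trans h2)// -addrA lerD2l -(@meshS R M' j).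
rewrite (_ : _ + _ = ((a i)%:R + 1) * mesh j.+1); last by ring.
by rewrite ler_pM2r// natr1 ler_nat ltn_ord.
Qed.

Lemma grid_cube j x : cube 0 0 x -> exists2 y, y \in grid j & cube j y x.
Proof.
move=> x0; elim: j => [|j [y yj yx]]; first by exists 0; rewrite ?mem_head.
have [a ax] := cube_child yx; exists (child j y a) => //.
rewrite gridS; apply/mapP; exists (y, a) => //.
by apply: allpairs_f => //; rewrite mem_enum.
Qed.

Lemma cube_norm j z x : cube j z x -> `|x - z| < mesh j.
Proof.
move=> zx; apply: norm_lt_coord; first exact: mesh_gt0.
move=> i; have /andP[h1 h2] := zx i; rewrite !mxE ger0_norm ?subr_ge0//.
by rewrite ltrBlDl.
Qed.

Lemma cube_dist j z x y : cube j z x -> cube j z y -> `|x - y| < mesh j.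
Proof.
move=> zx zy; apply: norm_lt_coord; first exact: mesh_gt0.
move=> i; have /andP[h1 h2] := zx i; have /andP[h3 h4] := zy i.
by rewrite !mxE ltr_norml; apply/andP; split; lra.
Qed.

Variables (u : R) (G : set V).
Hypothesis ud : u <= d%:R.
Local Notation kappa := (M `^ (- u)).

(** The content of the part of G that consists of cubes of the next k levels, when
    only M-adic cubes are used as covers, normalised so that a cube contained in
    G has content 1. *)
Fixpoint net k j z : R :=
  if k is k'.+1 then Num.min 1 (kappa * \sum_a net k' j.+1 (child j z a))
  else if `[< cube j z `<=` G >] then 1 else 0.

Lemma kappa_gt0 : 0 < kappa.
Proof. by apply: powR_gt0; rewrite ltr0n. Qed.

Lemma net_ge0 k j z : 0 <= net k j z.
Proof.
elim: k j z => [|k IH] j z /=; first by case: ifP.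
by rewrite le_min ler01/= mulr_ge0 ?(ltW kappa_gt0)// sumr_ge0.
Qed.

Lemma net_le1 k j z : net k j z <= 1.
Proof. by case: k => [|k] /=; [case: ifP|rewrite ge_min lexx]. Qed.

Lemma card_digits : #|{: digits}|%:R = M ^+ d :> R.
Proof. by rewrite card_ffun !card_ord natrX. Qed.

(** This is where u <= d enters: the children of a cube together cost at least
    as much as the cube. *)
Lemma kappa_card : 1 <= kappa * #|{: digits}|%:R.
Proof.
rewrite card_digits -powR_mulrn// -powRD; last by rewrite pnatr_eq0 implybT.
by rewrite -[leLHS](powRr0 M) ler_powR ?ler1n// addrC subr_ge0.
Qed.

Lemma net_nondec k j z : net k j z <= net k.+1 j z.
Proof.
elim: k j z => [|k IH] j z; last first.
  rewrite /= le_min !ge_min lexx/=; apply/orP; right.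
  by rewrite ler_pM2l ?kappa_gt0//; apply: ler_sum => a _; exact: IH.
rewrite /=; case: ifP => [/asboolP zG|_]; last first.
  by rewrite le_min ler01/= mulr_ge0 ?(ltW kappa_gt0)// sumr_ge0// => a _; exact: (net_ge0 0).
rewrite le_min lexx/= (eq_bigr (fun _ => 1)).
  by rewrite sumr_const -[X in _ * X]mulr_natl mulr1 kappa_card.
by move=> a _; rewrite asboolT//; apply: subset_trans zG; exact: sub_cube_child.
Qed.

Lemma net0_sub j z :
  net 0 j z <= kappa * \sum_a net 0 j.+1 (z + mesh j.+1 *: digit_vec a).
Proof. by apply: le_trans (net_nondec 0 j z) _; rewrite /= ge_min lexx orbT. Qed.

Definition netoo j z : R := limn (fun k => net k j z).

Let net_homo j z : nondecreasing_seq (fun k => net k j z).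
Proof. by apply/nondecreasing_seqP => k; exact: net_nondec. Qed.

Let net_cvg j z : cvgn (fun k => net k j z).
Proof.
apply: nondecreasing_is_cvgn => //.
by exists 1 => _ [k _ <-]; exact: net_le1.
Qed.

Lemma net_le_oo k j z : net k j z <= netoo j z.
Proof. exact: nondecreasing_cvgn_le. Qed.

Lemma netoo_le b j z : (forall k, net k j z <= b) -> netoo j z <= b.
Proof. by move=> h; apply: limr_le => //; apply: nearW. Qed.

Lemma netoo_le1 j z : netoo j z <= 1.
Proof. by apply: netoo_le => k; exact: net_le1. Qed.

(** The minimum with 1 in the definition of [net] is inactive along the whole
    sequence, and the relation passes to the limit in a finite sum. *)
Lemma netoo_sum j z : netoo j z < 1 ->
  kappa * \sum_a netoo j.+1 (child j z a) <= netoo j z.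
Proof.
move=> lt1; have : kappa * \sum_a net k j.+1 (child j z a) @[k --> \oo] -->
    kappa * \sum_a netoo j.+1 (child j z a).
  by apply: cvgMr; apply: cvg_sum_seq => a; exact: net_cvg.
move/cvgr_to_le; apply; apply: nearW => k.
have := net_le_oo k.+1 j z; rewrite /= ge_min => /orP[|//].
by rewrite leNgt lt1.
Qed.

(** The cubes, l levels below the given one, at which [netoo] takes the value 1 for
    the first time on the way down; they are given as balls around their corners. *)
Fixpoint cut l j z : seq (V * R) :=
  if netoo j z == 1 then if l is 0 then [:: (z, mesh j)] else [::]
  else if l is l'.+1 then flatten [seq cut l' j.+1 (child j z a) | a <- enum {: digits}]
  else [::].

(** Above the cut, [netoo] dominates the sum of its values at the children, so the
    total cost of the cut cubes telescopes. *)
Lemma cut_weight L j z :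
  \sum_(l < L) weight u (cut l j z) <= mesh j `^ u * netoo j z.
Proof.
have netoo0 : 0 <= netoo j z by exact: le_trans (net_ge0 0 j z) (net_le_oo _ _ _).
elim: L j z netoo0 => [|L IH] j z n0.
  by rewrite big_ord0 mulr_ge0 ?powR_ge0.
rewrite big_ord_recl /=; have [n1|n1] := eqVneq (netoo j z) 1.
  rewrite {1}/weight big_seq1/= big1 ?addr0 ?n1 ?mulr1// => l _.
  by rewrite /weight big_nil.
rewrite {1}/weight big_nil add0r.
under eq_bigr do rewrite /weight big_flatten big_map.
rewrite exchange_big/=.
apply: (@le_trans _ _ (\sum_(a <- enum {: digits})
    mesh j.+1 `^ u * netoo j.+1 (child j z a))).
  apply: ler_sum => a _; apply: IH.
  exact: le_trans (net_ge0 0 _ _) (net_le_oo _ _ _).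
rewrite -mulr_sumr big_enum/=.
have lt1 : netoo j z < 1 by rewrite lt_neqAle n1 netoo_le1.
have -> : mesh j.+1 `^ u = mesh j `^ u * kappa.
  rewrite -(@meshS R M' j) powRM ?(ltW (@mesh_gt0 R M' _))// mulrAC -powRD.
    by rewrite subrr powRr0 mul1r.
  by rewrite pnatr_eq0 implybT.
by rewrite -mulrA ler_wpM2l ?powR_ge0 ?netoo_sum.
Qed.

(** A cube contained in G has [netoo] equal to 1, so on the way down to a point of G
    the cut is met at the latest at such a cube. *)
Lemma cut_cover l j z x : cube j z x ->
  (forall z', cube (j + l) z' x -> cube (j + l) z' `<=` G) ->
  exists l', exists2 b, b \in cut l' j z & `|x - b.1| < b.2.
Proof.
elim: l j z => [|l IH] j z zx xG.
  have n1 : netoo j z = 1.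
    apply/eqP; rewrite eq_le netoo_le1/= (le_trans _ (net_le_oo 0 _ _))//=.
    by rewrite asboolT//; have := xG z; rewrite addn0; exact.
  by exists 0; exists (z, mesh j); rewrite /= ?n1 ?eqxx ?mem_head//; exact: cube_norm.
have [n1|n1] := eqVneq (netoo j z) 1.
  by exists 0; exists (z, mesh j); rewrite /= ?n1 ?eqxx ?mem_head//; exact: cube_norm.
have [a ax] := cube_child zx.
have [|l' [b bl xb]] := IH _ _ ax; first by move=> z'; rewrite addSnnS; exact: xG.
exists l'.+1; exists b => //=; rewrite (negPf n1); apply/flattenP.
by exists (cut l' j.+1 (child j z a)) => //; apply: map_f; rewrite mem_enum.
Qed.

Lemma cut_radius l j z b : b \in cut l j z -> 0 < b.2.
Proof.
elim: l j z => [|l IH] j z /=; case: ifP => // _.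
  by rewrite inE => /eqP ->; exact: mesh_gt0.
by move=> /flattenP[s /mapP[a _ ->]]; exact: IH.
Qed.

Hypothesis M'0 : (0 < M')%N.

Lemma mesh_small (e : R) : 0 < e -> exists j, mesh j < e.
Proof.
move=> e0; have [j je] := ltr_add_invr (ltac:(exact: e0) : 0 < e).
exists j; apply: (@le_lt_trans _ _ j.+1%:R^-1); last by rewrite add0r in je.
rewrite /mesh lef_pV2 ?posrE ?exprn_gt0//.
rewrite -natrX ler_nat.
elim: j {je} => // j IH; rewrite expnS.
apply: (@leq_trans (2 * M'.+1 ^ j)); last by rewrite leq_mul2r ltnS M'0 orbT.
by rewrite mul2n -addnn -addn1 leq_add// (leq_trans _ IH).
Qed.

(** Exhaustion from inside.  If the contents of all finite levels stayed below c',
    then so would their limit, and the cubes of the cut would cover A at a cost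
    of at most c' (the increasing sets lemma of Davies, which is easy for
    nets). *)
Lemma net_content (A : set V) (c : R) : open G -> A `<=` G ->
  A `<=` cube 0 0 ->
  (forall F e, economical u e F -> A `<=` covered F -> c <= e) ->
  forall c', c' < c -> exists J, c' < net J 0 0.
Proof.
move=> oG AG A0 Ac c' c'c; apply: contrapT => /forallNP hn.
have noo : netoo 0 0 <= c' by apply: netoo_le => k; rewrite leNgt; exact/negP/hn.
have : c <= c'; last by rewrite leNgt c'c.
apply: (Ac (fun l => cut l 0 0)).
  split=> [l b|L]; first exact: cut_radius.
  by rewrite (le_trans (cut_weight _ _ _))// mesh0 powR1 mul1r.
move=> x Ax; have /AG Gx := Ax.
have /nbhs_ballP[r /= r0 rG] := open_nbhs_nbhs (conj oG Gx).
have [l lr] := mesh_small r0.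
apply: (@cut_cover l 0 0); first exact: A0.
move=> z' xz' y yz'; apply: rG; rewrite -ball_normE/=.
by apply: lt_trans lr; exact: cube_dist xz' yz'.
Qed.

End Content.

(** * Few translations move a large set over the unit cube *)

Section FewTranslations.
Context {R : realType} {d M' : nat}.
Local Notation V := 'rV[R]_d.
Local Notation M := (M'.+1%:R : R).
Local Notation digits := {ffun 'I_d -> 'I_M'.+1}.
Local Notation shifts := {ffun 'I_d -> 'I_(M'.*2.+1)}.
Local Notation mesh := (@mesh R M').
Local Notation grid := (@grid R d M').
Local Notation cube := (@cube R d M').

Lemma norm_shift_vec (b : shifts) : `|@shift_vec R d M' b| <= M'%:R.
Proof.
apply: norm_le_coord => // i; rewrite mxE ler_distl subrr ler0n/=.
by rewrite -natrD ler_nat addnn -ltnS.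
Qed.

Lemma geometric_small (t e : R) : 0 < t <= 1 -> 0 < e ->
  exists m, (1 - t) ^+ m <= e.
Proof.
move=> /andP[t0 t1] e0; exists (Num.truncn ((t * e)^-1)).+1.
set m := _.+1; have mt : (t * e)^-1 <= m%:R by rewrite ltW// truncnS_gt.
have te : 0 < t * e by rewrite mulr_gt0.
apply: (@le_trans _ _ (expR (- (m%:R * t)))).
  rewrite -mulrN expRM_natl lerXn2r ?nnegrE ?expR_ge0 ?subr_ge0//.
  exact: expR_ge1Dx.
rewrite expRN invf_ple ?posrE ?expR_gt0//.
apply: le_trans (expR_ge1Dx _).
rewrite invfM in mt; have : t^-1 * e^-1 * t <= m%:R * t by rewrite ler_pM2r.
by rewrite mulrAC mulVf ?gt_eqF// mul1r; lra.
Qed.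

Section selection.
Variables (h : nat -> V -> R) (kappa : R) (K m : nat).
Hypothesis h01 : forall j z, 0 <= h j z <= 1.
Hypothesis hsub : forall j z,
  h j z <= kappa * \sum_a h j.+1 (z + mesh j.+1 *: @digit_vec R d M' a).
Hypothesis Kbig : 4 * kappa * (M'.*2.+1 ^ d)%:R <= K%:R.
Local Notation N := (#|{: digits}|%:R : R).
Hypothesis hm : (1 - h 0 0 / 2) ^+ m <= N^-1.

(** Iteration of [survival_step].  The lists of the earlier levels are kept as
    approximations of the final translations: later refinements move a
    translation of level j by less than the mesh of level j. *)
Lemma selection J : exists C : seq V, [/\ size C = (m * K ^ J)%N,
  \sum_(y <- grid J) survival h J C y <= N^-1 &
  forall j, (j <= J)%N -> exists2 L : seq V, size L = (m * K ^ j)%N &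
    forall c, c \in C -> exists2 l, l \in L & `|c - l| <= mesh j - mesh J].
Proof.
elim: J => [|J [C [sC CN CL]]].
  exists (nseq m 0); split; first by rewrite size_nseq muln1.
    rewrite (_ : grid 0 = [:: 0])// big_seq1 /survival big_nseq iter_mulr_1.
    by rewrite subr0.
  move=> j; rewrite leqn0 => /eqP ->; exists (nseq m 0); first by rewrite size_nseq muln1.
  by move=> c cm; exists c => //; rewrite !subrr normr0.
have [C' [sC' CN' CC']] := survival_step h01 hsub Kbig CN.
exists C'; split=> //; first by rewrite sC' sC expnSr mulnA.
move=> j; rewrite leq_eqVlt => /predU1P[->|/CL[L sL Ll]].
  exists C'; first by rewrite sC' sC expnSr mulnA.
  by move=> c cC'; exists c => //; rewrite !subrr normr0.
exists L => // c' /CC'[c /Ll[l lL cl] [b ->]]; exists l => //.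
rewrite addrAC (le_trans (ler_normD _ _))//.
have m0 := @mesh_gt0 R M' J.+1.
apply: (le_trans (lerD cl (_ : _ <= mesh J.+1 * M'%:R))).
  by rewrite normrZ gtr0_norm// ler_pM2l// norm_shift_vec.
by rewrite -(@meshS R M' J) -natr1; lra.
Qed.

End selection.

Hypothesis d0 : (0 < d)%N.
Hypothesis M'0 : (0 < M')%N.

(** The number m serves all sets A of content at least c and all open sets G that
    contain A.  This uniformity is crucial: G will be given by a cover whose cost has to be
    small compared with 1 / m. *)
Lemma few_translations (u c : R) (K : nat) : u <= d%:R -> 0 < c ->
  4 * M `^ (- u) * (M'.*2.+1 ^ d)%:R <= K%:R -> (0 < K)%N ->
  exists m : nat, forall A G : set V, open G -> A `<=` G -> A `<=` cube 0 0 ->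
    (forall F e, economical u e F -> A `<=` covered F -> c <= e) ->
  exists C : seq V,
    (forall y, cube 0 0 y -> exists2 t, t \in C & G (y - t)) /\
    forall j, exists2 L : seq V, (size L <= m * K ^ j)%N &
      forall t, t \in C -> exists2 l, l \in L & `|t - l| <= mesh j.
Proof.
move=> ud c0 Kbig K0.
(* net exceeds c / 2 at the root, so a single translation fails there with
   probability at most 1 - c / 4. *)
pose t := Num.min c 1 / 4.
have t01 : 0 < t <= 1.
  rewrite /t; have : 0 < Num.min c 1 <= 1 by rewrite lt_min c0 ltr01 ge_min lexx orbT.
  by lra.
have N0 : 0 < (#|{: digits}|%:R : R).
  by rewrite ltr0n; apply/card_gt0P; exists [ffun=> ord0].
have [m hm] := geometric_small t01 (ltac:(by rewrite invr_gt0) : 0 < (#|{: digits}|%:R : R)^-1).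
exists m => A G oG AG A0 Ac.
have [J cJ] : exists J, c / 2 < @net R d M' u G J 0 0.
  by apply: (@net_content _ _ _ u G ud M'0 A c) => //; lra.
pose h j z := @net R d M' u G (J - j) j z.
have h01 j z : 0 <= h j z <= 1 by rewrite /h net_ge0 net_le1.
have hsub j z : h j z <=
    M `^ (- u) * \sum_a h j.+1 (z + mesh j.+1 *: @digit_vec R d M' a).
  rewrite /h; have [Jj|jJ] := leqP J j.
    rewrite (eqP Jj) (_ : (J - j.+1)%N = 0%N); last by apply/eqP; rewrite subn_eq0 ltnW.
    exact: net0_sub.
  by rewrite -(subnSK jJ) /= ge_min lexx orbT.
have hm' : (1 - h 0 0 / 2) ^+ m <= (#|{: digits}|%:R : R)^-1.
  apply: le_trans hm; have /andP[h0 h1] := h01 0 0.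
  have : Num.min c 1 <= c by rewrite ge_min lexx.
  move: cJ; rewrite -[J]subn0 -/(h 0 0) => cJ mc.
  by rewrite lerXn2r ?nnegrE /t; move: h1 cJ mc; clear; lra.
have [C [sC CN CL]] := selection h01 hsub Kbig hm' J.
exists C; split; last first.
  move=> j; have [/CL[L sL Ll]|Jj] := leqP j J.
    exists L; rewrite ?sL// => s /Ll[l lL sl]; exists l => //.
    by rewrite (le_trans sl)// gerBl ltW// mesh_gt0.
  exists C; first by rewrite sC leq_mul2l leq_pexp2l ?orbT// ltnW.
  by move=> s sC'; exists s => //; rewrite subrr normr0 ltW// mesh_gt0.
move=> y /(grid_cube J)[z zJ zy].
have sv : survival h J C z < 1.
  apply: (@le_lt_trans _ _ (#|{: digits}|%:R : R)^-1).
    apply: le_trans CN; rewrite (big_rem z)//= lerDl.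
    by apply: sumr_ge0 => z' _; apply: survival_ge0.
  rewrite invf_lt1// card_digits -natrX -{1}[1]/(1%:R) ltr_nat.
  by rewrite -{1}(expn0 M'.+1) ltn_exp2l.
have [s sC' hs] : exists2 s, s \in C & 0 < h J (z - s).
  apply: contrapT => no; move: sv; rewrite /survival big_seq big1 ?ltxx//.
  move=> s sC'; have /eqP -> : h J (z - s) == 0; last by rewrite mul0r subr0.
  rewrite eq_le andbC; have /andP[-> _] := h01 J (z - s).
  by rewrite leNgt; apply/negP => hs; apply: no; exists s.
exists s => //; move: hs; rewrite /h subnn /=; case: ifP => [/asboolP zG _|]; last by rewrite ltxx.
by apply: zG => i; have /andP[] := zy i; rewrite !mxE; clear => ? ?; apply/andP; split; lra.
Qed.

End FewTranslations.

(** * Null sets and Hausdorff measure *)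

Lemma powR_le_inv (R : realType) (u x y : R) : 0 < u -> 0 <= x -> 0 <= y ->
  x `^ u <= y `^ u -> x <= y.
Proof.
move=> u0 x0 y0; apply: contraTT; rewrite -!ltNge => yx.
by apply: gt0_ltr_powR; rewrite ?nnegrE.
Qed.

Section NullSets.
Context {R : realType} {k : nat}.
Local Notation V := 'rV[R]_k.
Implicit Types (A B : set V) (F : nat -> seq (V * R)) (u e : R).

Lemma economical_le u e e' F : e <= e' -> economical u e F -> economical u e' F.
Proof. by move=> ee' [F0 Fe]; split=> // L; exact: le_trans (Fe L) ee'. Qed.

Lemma economical_radius u e F l b : economical u e F -> b \in F l ->
  b.2 `^ u <= e.
Proof.
move=> [_ Fe] bl; apply: le_trans (Fe l.+1).
rewrite big_ord_recr/= -[leLHS]add0r lerD//.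
  by apply: sumr_ge0 => i _; exact: weight_ge0.
rewrite /weight (big_rem b)//= lerDl.
by apply: sumr_ge0 => i _; exact: powR_ge0.
Qed.

(** The l-th list collects the lists Fs i j with max (i, j) = l, so that the first
    L lists are made of the square of the indices below L. *)
Lemma economical_bigcup u (Fs : nat -> nat -> seq (V * R)) (es : nat -> R) e :
  (forall i, economical u (es i) (Fs i)) ->
  (forall L, \sum_(i < L) es i <= e) ->
  exists2 F, economical u e F & forall i, covered (Fs i) `<=` covered F.
Proof.
move=> Fse ese.
pose F l := flatten [seq Fs i l | i <- index_iota 0 l] ++
  flatten [seq Fs l j | j <- index_iota 0 l.+1].
exists F.
  split=> [l b|L].
    by rewrite mem_cat => /orP[] /flattenP[s /mapP[i _ ->]] /(Fse _).1.
  apply: le_trans (ese L).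
  apply: (@le_trans _ _ (\sum_(i < L) \sum_(j < L) weight u (Fs i j))).
    rewrite le_eqVlt; apply/orP; left; apply/eqP.
    elim: L => [|L IH]; first by rewrite !big_ord0.
    rewrite big_ord_recr IH/= [RHS]big_ord_recr/=.
    rewrite [in RHS](eq_bigr (fun i : 'I_L =>
      \sum_(j < L) weight u (Fs i j) + weight u (Fs i L))); last first.
      by move=> i _; rewrite big_ord_recr.
    rewrite big_split/= -addrA; congr (_ + _).
    rewrite /F weight_cat; congr (_ + _).
      by rewrite /weight big_flatten big_map big_mkord.
    by rewrite /weight big_flatten big_map big_mkord.
  by apply: ler_sum => i _; exact: (Fse i).2.
move=> i x [j [b bj xb]]; exists (maxn i j), b => //; rewrite mem_cat.
have [ij|ji] := ltnP i j.
  apply/orP; left; apply/flattenP; exists (Fs i j) => //.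
  by apply/mapP; exists i; rewrite // mem_index_iota.
apply/orP; right; apply/flattenP; exists (Fs i j) => //.
by apply/mapP; exists j; rewrite // mem_index_iota ltnS.
Qed.

Lemma sum_half_le (e : R) L : 0 <= e -> \sum_(i < L) e / 2 ^+ i.+1 <= e.
Proof.
move=> e0; suff -> : \sum_(i < L) e / 2 ^+ i.+1 = e - e / 2 ^+ L.
  by rewrite gerBl divr_ge0// exprn_ge0.
elim: L => [|L IH]; first by rewrite big_ord0 expr0 divr1 subrr.
rewrite big_ord_recr/= IH exprS; field.
by rewrite expf_eq0 pnatr_eq0 andbF.
Qed.

Lemma null_sub u A B : A `<=` B -> null u B -> null u A.
Proof. by move=> AB nB e /nB[F Fe BF]; exists F => //; exact: subset_trans BF. Qed.

Lemma null_bigcup u (A : nat -> set V) : (forall i, null u (A i)) ->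
  null u (\bigcup_i A i).
Proof.
move=> nA e e0.
have /choice[Fs Fse] i : exists F, economical u (e / 2 ^+ i.+1) F /\ A i `<=` covered F.
  have [|F ? ?] := nA i (e / 2 ^+ i.+1); first by rewrite divr_gt0// exprn_gt0.
  by exists F.
have [F Fe FsF] := economical_bigcup (fun i => (Fse i).1) (fun L => sum_half_le L (ltW e0)).
by exists F => // x [i _ Aix]; apply: (FsF i); exact: (Fse i).2.
Qed.

Lemma null_set0 u : null u (set0 : set V).
Proof.
move=> e e0; exists (fun=> [::]) => //; split=> // L.
by rewrite big1 ?ltW// => i _; rewrite /weight big_nil.
Qed.

Lemma null_bigcup_countable u (I : countType) (A : I -> set V) :
  (forall i, null u (A i)) -> null u (\bigcup_i A i).
Proof.
move=> nA; pose B j := if unpickle j is Some i then A i else set0.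
apply: (@null_sub _ _ (\bigcup_j B j)).
  by move=> x [i _ Aix]; exists (pickle i) => //; rewrite /B pickleK.
by apply: null_bigcup => j; rewrite /B; case: unpickle => // *; exact: null_set0.
Qed.

(** Each ball has cost 1 in dimension 0. *)
Lemma null0_set0 A : null 0 A -> A = set0.
Proof.
move=> /(_ 2^-1); rewrite invr_gt0 => /(_ (ltr0n _ 2)) [F Fe AF].
rewrite -subset0 => x /AF[l [b bl _]].
by have := economical_radius Fe bl; rewrite powRr0; lra.
Qed.

Lemma not_null_content u A : ~ null u A ->
  exists2 c, 0 < c & forall F e, economical u e F -> A `<=` covered F -> c <= e.
Proof.
move=> /existsNP[c /not_implyP[c0 h]]; exists c => // F e Fe AF.
rewrite leNgt; apply/negP => ec; apply: h; exists F => //.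
by apply: economical_le Fe; exact: ltW.
Qed.

End NullSets.

Section Enumeration.
Context {R : realType} {X : eqType}.

(** The lists are concatenated, each preceded by a blank None; the blank ensures
    that the first N lists reach beyond position N even if they are empty. *)
Lemma enumerate_lists (F : nat -> seq X) (w : X -> R) (e : R) :
  (forall x, 0 <= w x) -> (forall L, \sum_(l < L) \sum_(b <- F l) w b <= e) ->
  exists g : nat -> option X,
  [/\ forall N, \sum_(i < N) oapp w 0 (g i) <= e,
      forall l x, x \in F l -> exists i, g i = Some x &
      forall i x, g i = Some x -> exists l, x \in F l].
Proof.
move=> w0 Fe.
pose F' l := None :: [seq Some b | b <- F l].
pose P N := flatten [seq F' l | l <- iota 0 N].
have PS N : P N.+1 = P N ++ F' N.
  by rewrite /P -addn1 iotaD map_cat flatten_cat /= cats0.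
have sP N : (N <= size (P N))%N.
  elim: N => // N IH; rewrite PS size_cat /= addnS ltnS (leq_trans IH)//.
  by rewrite leq_addr.
have Pm N m i : (N <= m)%N -> (i < size (P N))%N -> nth None (P m) i = nth None (P N) i.
  move=> /subnK <-; elim: (m - N)%N => // p IH iN; rewrite addSn PS nth_cat.
  rewrite (_ : (i < _)%N) ?IH//.
  apply: (leq_trans iN); elim: p {IH} => // p; rewrite addSn PS size_cat => /leq_trans; apply.
  by rewrite leq_addr.
pose g i := nth None (P i.+1) i.
have gP N i : (i < size (P N))%N -> g i = nth None (P N) i.
  move=> iN; rewrite /g; have [h|/ltnW h] := leqP i.+1 N; first by rewrite (Pm i.+1 N).
  by rewrite (Pm N).
have sumP N : \sum_(b <- P N) oapp w 0 b <= e.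
  apply: le_trans (Fe N); rewrite le_eqVlt; apply/orP; left; apply/eqP.
  elim: N => [|N IH]; first by rewrite /P big_nil big_ord0.
  rewrite PS big_cat IH/= big_ord_recr; congr (_ + _).
  by rewrite /F' big_cons add0r big_map.
exists g; split.
- move=> N; apply: le_trans (sumP N).
  rewrite -[in leRHS](cat_take_drop N (P N)) big_cat/=.
  rewrite (big_nth None) size_takel// big_mkord -[leLHS]addr0 lerD//.
    apply: ler_sum => i _; rewrite nth_take// (gP N)//.
    exact: leq_trans (ltn_ord i) (sP N).
  by apply: sumr_ge0 => -[b|] _ /=.
- move=> l x lx; have xP : Some x \in P l.+1.
    by rewrite PS mem_cat inE map_f ?orbT.
  by exists (index (Some x) (P l.+1)); rewrite (gP l.+1) ?index_mem// nth_index.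
- move=> i x gi; have : Some x \in P i.+1 by rewrite -gi; apply: mem_nth; exact: sP.
  move=> /flattenP[s /mapP[l _ ->]]; rewrite inE /= => /mapP[y yl [xy]].
  by exists l; rewrite xy.
Qed.

End Enumeration.

Section NullHausdorff.
Context {R : realType} {k : nat} {T : Type} (dist : T -> T -> R).
Local Notation V := 'rV[R]_k.
Hypothesis dist_ge0 : forall s t, 0 <= dist s t.

Lemma diam_le (c : R) (U : set T) : 0 <= c ->
  (forall s t, U s -> U t -> dist s t <= c) -> (diam dist U <= c%:E)%E.
Proof.
move=> c0 Uc; apply: ge_ereal_sup => _ [[s t] [/= Us Ut] <-].
by rewrite lee_fin; exact: Uc.
Qed.

Lemma hweight_le (u c : R) (U : set T) : 0 <= u -> 0 <= c ->
  (forall s t, U s -> U t -> dist s t <= c) -> (hweight dist u U <= (c `^ u)%:E)%E.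
Proof.
move=> u0 c0 Uc; rewrite /hweight; case: ifPn => [_|/set0P[t Ut]].
  by rewrite lee_fin powR_ge0.
have dU : (0 <= diam dist U)%E.
  apply: (@le_trans _ _ (dist t t)%:E); first by rewrite lee_fin.
  by apply: ereal_sup_ubound; exists (t, t).
have Uc' := diam_le c0 Uc.
by rewrite -poweR_EFin gt0_ler_poweR ?in_itv/= ?leey ?andbT ?lee_fin.
Qed.

Lemma hausdorff_content_ge0 (u e : R) (A : set T) :
  (0 <= hausdorff_content dist u e A)%E.
Proof.
apply: le_ereal_inf_tmp => _ [U _ <-]; apply: nneseries_ge0 => i _ _.
by rewrite /hweight; case: ifP => // _; exact: poweR_ge0.
Qed.

(** Lipschitz images of null sets have zero measure.  The parametrisations r i are
    relations, indexed by a finite type, because projective space needs several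
    charts. *)
Lemma null_hausdorff_measure (I : finType) (u c : R) (B : I -> set V) (A : set T)
    (r : I -> V -> T -> Prop) : 0 < u -> 0 < c ->
  (forall i x y s t, r i x s -> r i y t -> dist s t <= c * `|x - y|) ->
  (forall t, A t -> exists i, exists2 x, B i x & r i x t) ->
  (forall i, null u (B i)) -> hausdorff_measure dist u A = 0%E.
Proof.
move=> u0 c0 rc AB nB; apply/eqP; rewrite eq_le; apply/andP; split; last first.
  apply: le_trans (hausdorff_content_ge0 u 1 A) _.
  by apply: ereal_sup_ubound => /=; exists 1; rewrite /= ?ltr01.
apply: ge_ereal_sup => _ [e /= e0 <-]; apply/lee_addgt0Pr => eta eta0; rewrite add0e.
have c2 : 0 < 2 * c by rewrite mulr_gt0.
pose e1 := Num.min (eta / (2 * c) `^ u) ((e / (2 * c)) `^ u).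
have e10 : 0 < e1.
  by rewrite lt_min divr_gt0 ?powR_gt0// divr_gt0.
pose e2 := e1 / #|I|.+1%:R.
have e20 : 0 < e2 by rewrite divr_gt0.
have /choice[Fs Fse] i : exists F, economical u e2 F /\ B i `<=` covered F.
  by have [F ? ?] := nB i e2 e20; exists F.
pose F l := [seq (i, b) | i <- enum I, b <- Fs i l].
have [||g [gs gF Fg]] := @enumerate_lists R (I * (V * R))%type F (fun b => b.2.2 `^ u) e1.
- by move=> b; exact: powR_ge0.
- move=> L; apply: (@le_trans _ _ (\sum_(l < L) \sum_(i : I) weight u (Fs i l))).
    apply: ler_sum => l _; rewrite /F big_allpairs_dep/= big_enum/=.
    by apply: ler_sum.
  rewrite exchange_big/=; apply: (@le_trans _ _ (\sum_(i : I) e2)).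
    by apply: ler_sum => i _; exact: (Fse i).1.2.
  rewrite sumr_const -[leLHS]mulr_natr /e2 mulrAC ler_pdivrMr//.
  by rewrite ler_pM2l// ler_nat leqnSn.
have Fgb i b : g i = Some b -> exists l, b.2 \in Fs b.1 l.
  by move=> /Fg[l /allpairsPdep[j [b' [_ bl ->]]]]; exists l.
pose U i := if g i is Some b then
  [set t | exists2 x, `|x - b.2.1| < b.2.2 & r b.1 x t] else set0.
have Uc i s t : U i s -> U i t -> dist s t <= 2 * c * oapp (fun b => b.2.2) 0 (g i).
  rewrite /U; case: (g i) => [b|//] [x xb xs] [y yb yt] /=.
  apply: (le_trans (rc _ _ _ _ _ xs yt)).
  rewrite (mulrC 2) -mulrA ler_pM2l// mulr_natl mulr2n.
  rewrite -(subrKA b.2.1) (le_trans (ler_normD _ _))//.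
  by rewrite (distrC _ y) lerD// ltW.
have rad i : 0 <= oapp (fun b => b.2.2) 0 (g i).
  case gi: (g i) => [b|//] /=; have [l bl] := Fgb _ _ gi.
  exact/ltW/((Fse _).1.1 _ _ bl).
apply: (@le_trans _ _ (\sum_(0 <= i <oo) hweight dist u (U i))%E).
  apply: ereal_inf_lbound; exists U => //; split.
    move=> t /AB[i [x /(Fse i).2[l [b bl xb]] xt]].
    have [|j gj] := gF l (i, b).
      by apply/allpairsPdep; exists i, b; rewrite mem_enum.
    by exists j => //; rewrite /U gj; exists x.
  move=> i; apply: diam_le => [|s t Us Ut]; first exact: ltW.
  apply: (le_trans (Uc _ _ _ Us Ut)).
  rewrite mulrC -ler_pdivlMr//; case gi: (g i) => [b|]/=; last by rewrite divr_ge0// ltW.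
  have [l bl] := Fgb _ _ gi.
  have := economical_radius (Fse _).1 bl => h.
  have b0 := (Fse _).1.1 _ _ bl.
  apply: (powR_le_inv u0); rewrite ?divr_ge0 ?(ltW b0) ?(ltW e0) ?(ltW c2)//.
  apply: (le_trans h); apply: (@le_trans _ _ e1); last by rewrite /e1 ge_min lexx orbT.
  by rewrite /e2 ler_piMr ?(ltW e10)// invf_le1// ler1n.
apply: lime_le.
  apply: is_cvg_nneseries => i _ _.
  by rewrite /hweight; case: ifP => // _; exact: poweR_ge0.
apply: nearW => N; rewrite big_mkord.
apply: (@le_trans _ _ (\sum_(i < N) ((2 * c) `^ u * oapp (fun b => b.2.2 `^ u) 0 (g i))%:E)%E).
  apply: lee_sum => i _; have := hweight_le (ltW u0) _ (Uc i).
  rewrite mulr_ge0 ?(ltW c2)// => /(_ isT) /le_trans; apply.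
  rewrite lee_fin powRM ?(ltW c2)//; case: (g i) => //=.
  by rewrite powR0 ?mulr0// gt_eqF.
rewrite sumEFin lee_fin -mulr_sumr.
apply: (@le_trans _ _ ((2 * c) `^ u * e1)); first by rewrite ler_wpM2l// powR_ge0.
by rewrite mulrC -ler_pdivlMr ?powR_gt0// /e1 ge_min lexx.
Qed.

End NullHausdorff.

(** * Null sets, dimension and cubes in R^n *)

Section CompactCovered.
Context {R : realType} {k : nat}.
Local Notation V := 'rV[R]_k.
Implicit Types (A S U : set V) (F : nat -> seq (V * R)).

Lemma covered_nbhs F x l b : b \in F l -> `|x - b.1| < b.2 ->
  \forall y \near x, `|y - b.1| < b.2.
Proof.
move=> bl xb; apply/nbhs_ballP; exists (b.2 - `|x - b.1|) => /=.
  by rewrite subr_gt0.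
move=> y; rewrite -ball_normE/= => xy.
rewrite -(subrKA x) (le_lt_trans (ler_normD _ _))// distrC.
by move: xy; lra.
Qed.

Lemma open_covered F : open (covered F).
Proof.
rewrite openE => x [l [b bl xb]]; rewrite /interior.
near=> y; exists l, b => //; near: y; apply: covered_nbhs bl xb.
Unshelve. all: by end_near. Qed.

Lemma compact_covered F S : compact S -> S `<=` covered F ->
  exists L, forall x, S x ->
    exists2 l, (l < L)%N & exists2 b, b \in F l & `|x - b.1| < b.2.
Proof.
move=> /compact_near_coveringP cS SF.
pose P L (x : V) := exists2 l, (l < L)%N & exists2 b, b \in F l & `|x - b.1| < b.2.
suff [L _ h] : \forall L \near \oo, S `<=` P L by exists L; exact: (h L (leqnn L)).
apply: cS => x /SF[l [b bl xb]].
near=> y L => /=; exists l; first by near: L; exists l.+1.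
by exists b => //; near: y; exact: covered_nbhs bl xb.
Unshelve. all: by end_near. Qed.

(** The Lebesgue number of the cover of S by the single open set U. *)
Lemma compact_open_nbhd S U : compact S -> open U -> S `<=` U ->
  exists2 r : R, 0 < r & forall x y, S x -> `|x - y| < r -> U y.
Proof.
move=> /compact_near_coveringP cS oU SU.
pose P (r : R) (x : V) := forall y, `|x - y| < r -> U y.
suff [e /= e0 h] : \forall r \near (0:R)^'+, S `<=` P r.
  exists (e / 2); first by rewrite divr_gt0.
  move=> x y Sx; apply: (h (e / 2)) => //=; last by rewrite divr_gt0.
  by rewrite sub0r normrN gtr0_norm ?divr_gt0//; lra.
apply: cS => x Sx.
have /nbhs_ballP[e /= e0 eU] := open_nbhs_nbhs (conj oU (SU x Sx)).
exists (ball x (e / 2), [set r | r < e / 2]) => /=.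
  split; first by apply: nbhsx_ballx; rewrite divr_gt0.
  by apply: nbhs_right_lt; rewrite divr_gt0.
move=> [y r] /= [xy re] z yz; apply: eU; rewrite -ball_normE/=.
move: xy; rewrite -ball_normE/= => xy.
rewrite -(subrKA y) (le_lt_trans (ler_normD _ _))//.
by move: yz re xy; lra.
Qed.

End CompactCovered.

Section Dimension.
Context {R : realType} {k : nat}.
Local Notation V := 'rV[R]_k.
Implicit Types (A : set V).

Lemma edist_le_norm (x y : V) : edist x y <= (Num.sqrt k%:R + 1) * `|x - y|.
Proof. by rewrite (le_trans (enorm_le _))// mulrDl mul1r lerDl. Qed.

Lemma dimH_le_of_null A (s : R) : 0 < s -> null s A -> (dimH A <= s%:E)%E.
Proof.
move=> s0 sA; apply: ge_ereal_inf; exists s%:E => //; exists s => //.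
split; first exact: ltW.
have c0 : 0 < Num.sqrt k%:R + 1 :> R by rewrite ltr_wpDl ?sqrtr_ge0.
apply: (@null_hausdorff_measure R k V edist edist_ge0 unit s (Num.sqrt k%:R + 1)
  (fun=> A) A (fun=> eq)) => //.
- by move=> _ x y _ _ <- <-; exact: edist_le_norm.
- by move=> t At; exists tt; exists t.
Qed.

(** Each set of diameter t is replaced by a ball around one of its points, of a
    radius slightly larger than t because the balls are open and t may be 0; the
    excess is summable, and t^s <= t^s1 as t <= 1. *)
Lemma null_of_dimH_lt A (s : R) : 0 < s -> (dimH A < s%:E)%E -> null s A.
Proof.
move=> s0 /ereal_inf_lt[_ [s1 [s10 mA] <-]]; rewrite lte_fin => s1s e e0.
have : (hausdorff_content edist s1 1 A < (e / 2)%:E)%E.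
  apply: (@le_lt_trans _ _ 0%E); last by rewrite lte_fin divr_gt0.
  by rewrite -mA; apply: ereal_sup_ubound; exists 1; rewrite /= ?ltr01.
move=> /ereal_inf_lt[_ [U [AU U1] <-]] sumU.
have dU i x y : U i x -> U i y -> `|x - y| <= fine (diam edist (U i)).
  move=> Ux Uy; rewrite -lee_fin (@le_trans _ _ (edist x y)%:E)//.
    by rewrite lee_fin norm_le_enorm.
  rewrite fineK; first by apply: ereal_sup_ubound; exists (x, y).
  rewrite fin_numElt (le_lt_trans (U1 i)) ?ltry// andbT.
  apply: (@lt_le_trans _ _ (edist x y)%:E); first exact: ltNyr.
  by apply: ereal_sup_ubound; exists (x, y).
pose t i := fine (diam edist (U i)) `^ s + e / 2 / 2 ^+ i.+1.
have e2 i : 0 < e / 2 / 2 ^+ i.+1 by rewrite !divr_gt0// exprn_gt0.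
have t0 i : 0 < t i by rewrite ltr_wpDl ?powR_ge0.
have tK i : (t i `^ s^-1) `^ s = t i.
  by rewrite -powRrM mulVf ?gt_eqF// powRr1// ltW.
pose F i := if pselect (U i !=set0) is left h then [:: (sval (cid h), t i `^ s^-1)]
  else [::].
exists F; last first.
  move=> x /AU[i _ Ux]; exists i; rewrite /F; case: pselect => [h|[]]; last by exists x.
  exists (sval (cid h), t i `^ s^-1); rewrite ?mem_head//=.
  have Uy := svalP (cid h); rewrite (le_lt_trans (dU _ _ _ Ux Uy))//.
  rewrite ltNge; apply/negP => h1.
  have d0 : 0 <= fine (diam edist (U i)) by exact: le_trans (normr_ge0 _) (dU _ _ _ Ux Ux).
  have : (t i `^ s^-1) `^ s <= fine (diam edist (U i)) `^ s.
    by apply: ge0_ler_powR => //; rewrite ?nnegrE ?powR_ge0// ltW.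
  by rewrite tK /t; have := e2 i; lra.
split=> [l b|L].
  rewrite /F; case: pselect => // h; rewrite inE => /eqP -> /=.
  exact: powR_gt0.
apply: (@le_trans _ _ (\sum_(i < L) (fine (hweight edist s1 (U i)) + e / 2 / 2 ^+ i.+1))).
  apply: ler_sum => i _; rewrite /F /hweight; case: pselect => h; last first.
    rewrite /weight big_nil (_ : U i == set0) ?add0r ?ltW//.
    by apply/eqP; rewrite -subset0 => x Ux; apply: h; exists x.
  have [x Ux] := h.
  rewrite /weight big_seq1/= tK /t ifF; last first.
    by apply/eqP => U0; rewrite U0 in Ux.
  rewrite lerD2r fine_poweR.
  have d0 : 0 <= fine (diam edist (U i)) by exact: le_trans (normr_ge0 _) (dU _ _ _ Ux Ux).
  have d1 : fine (diam edist (U i)) <= 1.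
    have dE : (0 <= diam edist (U i))%E.
      apply: (@le_trans _ _ (edist x x)%:E); first by rewrite lee_fin edist_ge0.
      by apply: ereal_sup_ubound; exists (x, x).
    by move: dE (U1 i); case: (diam _ _) => // r _; rewrite /= lee_fin.
  have [->|dn0] := eqVneq (fine (diam edist (U i))) 0.
    by rewrite (powR0 (lt0r_neq0 s0)) powR_ge0.
  by apply: ger_powR; [rewrite lt_neqAle eq_sym dn0 d0|exact: ltW].
rewrite big_split/=.
have h2 : \sum_(i < L) e / 2 / 2 ^+ i.+1 <= e / 2 by apply: sum_half_le; rewrite ltW// divr_gt0.
suff : \sum_(i < L) fine (hweight edist s1 (U i)) <= e / 2 by move: h2; lra.
have w0 i : (0 <= hweight edist s1 (U i))%E.
  by rewrite /hweight; case: ifP => // _; exact: poweR_ge0.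
have wfin i : hweight edist s1 (U i) \is a fin_num.
  rewrite ge0_fin_numE// /hweight; case: ifP => [_|_]; first exact: ltry.
  by apply: poweR_lty; rewrite (le_lt_trans (U1 i)) ?ltry.
rewrite -lee_fin -sumEFin (eq_bigr (fun i : 'I_L => hweight edist s1 (U i))); last first.
  by move=> i _; rewrite fineK.
apply/ltW; apply: le_lt_trans sumU.
have := @nneseries_lim_ge R (fun i => hweight edist s1 (U i)) xpredT 0 L.
by rewrite big_mkord; apply => *; exact: w0.
Qed.

Lemma size_grid M' j : size (@grid R k M' j) = ((M'.+1 ^ k) ^ j)%N.
Proof.
elim: j => // j IH; rewrite gridS size_map size_allpairs IH -cardT.
by rewrite card_ffun !card_ord expnSr.
Qed.

(** The 2^(k j) dyadic cubes of level j cost 2^(j (k - u)) together. *)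
Lemma null_cube (u : R) : k%:R < u -> null u (@cube R k 1 0 (0 : V)).
Proof.
move=> ku e e0.
pose q : R := 2 `^ (k%:R - u).
have q01 : 0 < q < 1.
  rewrite powR_gt0//= /q -[ltRHS](powRr0 2) /powR pnatr_eq0/= ltr_expR mul0r.
  by rewrite nmulr_rlt0 ?subr_lt0// ln_gt0// ltr1n.
have [||j qj] := @geometric_small R (1 - q) e.
- by have /andP[] := q01; lra.
- by [].
pose F l : seq (V * R) := if l is 0 then [seq (y, @mesh R 1 j) | y <- @grid R k 1 j] else [::].
exists F; last first.
  move=> x /(grid_cube j)[y yj yx]; exists 0%N, (y, @mesh R 1 j); first exact: map_f.
  exact: cube_norm.
split=> [[|l]//= b /mapP[y _ ->]|L]; first exact: mesh_gt0.
apply: le_trans qj.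
apply: (@le_trans _ _ (weight u (F 0))).
  case: L => [|L]; first by rewrite big_ord0 weight_ge0.
  rewrite big_ord_recl big1 ?addr0// => i _.
  by rewrite /weight big_nil.
rewrite /weight big_map /= big_const_seq count_predT iter_addr_0 size_grid.
rewrite opprB addrC subrK -mulr_natl.
rewrite /mesh -powR_invn// -powRrM !natrX -!powR_mulrn ?powR_ge0//.
rewrite -!powRrM -powRD ?pnatr_eq0 ?implybT//.
by rewrite ler_powR ?ler1n//; lra.
Qed.

(** All integers counted lie in an interval of length 2 rho that starts at the
    smallest of them. *)
Lemma count_near (N : nat) (alpha rho : R) : 0 < rho ->
  \sum_(m < N) (`|m%:R - alpha| < rho)%R%:R <= 2 * rho + 1.
Proof.
move=> rho0; pose p (m : nat) := `|(m%:R : R) - alpha| < rho.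
pose s := [seq m <- index_iota 0 N | p m].
have -> : \sum_(m < N) (`|m%:R - alpha| < rho)%R%:R = (size s)%:R :> R.
  rewrite /s size_filter -sum1_count natr_sum [RHS]big_mkcond/=.
  by rewrite big_mkord; apply: eq_bigr => i _; rewrite /p; case: ifP.
case E : s => [|m0 s']; first by rewrite /=; lra.
have m0s m : m \in s -> m%:R < m0%:R + 2 * rho /\ (m0 <= m)%N.
  move=> ms; have sm0 : m0 \in s by rewrite E mem_head.
  split.
    move: ms sm0; rewrite !mem_filter => /andP[+ _] /andP[+ _].
    by rewrite /p !ltr_norml => /andP[? ?] /andP[? ?]; lra.
  have : sorted leq s by apply: sorted_filter; [exact: leq_trans|exact: iota_sorted].
  rewrite E /= => /order_path_min => /(_ leq_trans) /allP h.
  by move: ms; rewrite E inE => /predU1P[->//|/h].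
rewrite -E.
have : (size s <= size (iota m0 (Num.truncn (2 * rho)).+1))%N.
  apply: uniq_leq_size; first by rewrite filter_uniq ?iota_uniq.
  move=> m /m0s[h1 h2]; rewrite mem_iota h2 -ltn_subLR//= ltnS.
  rewrite truncn_ge_nat; last by rewrite mulr_ge0 ?ltW.
  by rewrite natrB//; lra.
rewrite size_iota -(ler_nat R) => /le_trans; apply.
rewrite -natr1 lerD2r; have /andP[] := truncn_itv (ltac:(by rewrite mulr_ge0 ?ltW) : 0 <= 2 * rho).
by [].
Qed.

(** A finite subcover is tested on a grid of step 1 / (2 N) so fine that N r >= 1
    for all radii r: a ball contains at most (4 N r + 1)^k <= (5 N r)^k of the
    N^k grid points, so that the sum of r^k is at least 5^-k. *)
Lemma not_null_box : ~ null k%:R [set x : V | forall i, 1 / 4 <= x 0 i <= 3 / 4].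
Proof.
set S := [set x | _].
have cS : compact S.
  have := @rV_compact R k (fun=> `[1 / 4, 3 / 4]%classic) (fun=> @segment_compact R _ _).
  congr compact; apply/seteqP; split=> x h i; have := h i; rewrite /= in_itv/=; exact.
pose e : R := 5 ^- k / 2.
have e0 : 0 < e by rewrite divr_gt0// invr_gt0 exprn_gt0.
move=> /(_ e e0)[F [F0 Fe] SF].
have [L SL] := compact_covered cS SF.
pose s := flatten [seq F l | l <- index_iota 0 L].
have s0 b : b \in s -> 0 < b.2 by move=> /flattenP[_ /mapP[l _ ->]]; exact: F0.
have se : \sum_(b <- s) b.2 `^ k%:R <= e.
  by apply: le_trans (Fe L); rewrite /s big_flatten big_map big_mkord.
pose N := (Num.truncn (\sum_(b <- s) b.2^-1)).+1.
have N0 : 0 < N%:R :> R by rewrite ltr0n.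
have bN b : b \in s -> 1 <= b.2 * N%:R.
  move=> bs; rewrite mulrC -ler_pdivrMr ?s0// mul1r.
  apply: (@le_trans _ _ (\sum_(b <- s) b.2^-1)); last exact/ltW/truncnS_gt.
  rewrite (big_rem b)//= lerDl big_seq; apply: sumr_ge0 => c /mem_rem cs.
  by rewrite invr_ge0 ltW ?s0.
pose p (f : {ffun 'I_k -> 'I_N}) : V := \row_i (1 / 4 + (f i)%:R / (2 * N%:R)).
have pS f : S (p f).
  move=> i; rewrite mxE; apply/andP; split; first by rewrite lerDl divr_ge0// mulr_ge0.
  have : (f i)%:R / (2 * N%:R) <= (1:R) / 2.
    rewrite ler_pdivrMr ?mulr_gt0// mulrA mulfVK// mul1r.
    by rewrite ler_nat ltnW.
  lra.
pose ind (b : V * R) i (m : 'I_N) : R := (`|1 / 4 + m%:R / (2 * N%:R) - b.1 0 i| < b.2)%R%:R.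
have h1 (f : {ffun 'I_k -> 'I_N}) : 1 <= \sum_(b <- s) \prod_i ind b i (f i).
  have [l lL [b bl pb]] := SL _ (pS f).
  have bs : b \in s.
    by apply/flattenP; exists (F l) => //; apply: map_f; rewrite mem_index_iota.
  rewrite (big_rem b)//= -[leLHS]addr0 lerD//; last first.
    by apply: sumr_ge0 => c _; apply: prodr_ge0 => i _.
  rewrite big1// => i _; rewrite /ind; suff -> : `|1 / 4 + (f i)%:R / (2 * N%:R) - b.1 0 i| < b.2 by [].
  by apply: le_lt_trans pb; have := coord_le_norm (p f - b.1) i; rewrite !mxE.
have h2 : \sum_(f : {ffun 'I_k -> 'I_N}) 1 <= \sum_(b <- s) \prod_(i < k) \sum_(m < N) ind b i m.
  apply: (le_trans (ler_sum _ (fun f _ => h1 f))).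
  rewrite exchange_big/= le_eqVlt; apply/orP; left; apply/eqP; apply: eq_bigr => b _.
  by rewrite bigA_distr_bigA.
have h3 b : b \in s -> \prod_(i < k) \sum_(m < N) ind b i m <= 5 ^+ k * N%:R ^+ k * b.2 `^ k%:R.
  move=> bs; rewrite powR_mulrn ?(ltW (s0 _ bs))// -!exprMn.
  rewrite [leRHS](_ : _ = \prod_(i < k) (5 * N%:R * b.2)); last by rewrite prodr_const card_ord.
  apply: ler_prod => i _; apply/andP; split; first by apply: sumr_ge0.
  apply: (@le_trans _ _ (2 * (2 * N%:R * b.2) + 1)); last by have := bN b bs; nra.
  apply: le_trans (@count_near N (2 * N%:R * (b.1 0 i - 1 / 4)) (2 * N%:R * b.2) _); last first.
    by rewrite !mulr_gt0 ?s0.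
  apply: ler_sum => m _; rewrite /ind ler_nat leq_eqVlt; apply/orP; left; apply/eqP; congr nat_of_bool.
  have NN : 0 < 2 * N%:R :> R by rewrite mulr_gt0.
  rewrite (_ : m%:R - _ = 2 * N%:R * (1 / 4 + m%:R / (2 * N%:R) - b.1 0 i)); last first.
    by field; rewrite gt_eqF.
  by rewrite normrM gtr0_norm// ltr_pM2l.
have := le_trans h2 (_ : _ <= 5 ^+ k * N%:R ^+ k * e).
rewrite sumr_const card_ffun !card_ord natrX => /(_ _) h.
have Nk : 0 < N%:R ^+ k :> R by rewrite exprn_gt0.
have : N%:R ^+ k <= 5 ^+ k * N%:R ^+ k * e.
  apply: h; rewrite big_seq.
  apply: (@le_trans _ _ (\sum_(b <- s | b \in s) 5 ^+ k * N%:R ^+ k * b.2 `^ k%:R)).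
    exact: ler_sum.
  by rewrite -big_seq -mulr_sumr ler_wpM2l// mulr_ge0// exprn_ge0.
have k5 : 0 < 5 ^+ k :> R by rewrite exprn_gt0.
rewrite /e (_ : _ * _ * _ = N%:R ^+ k / 2); first by lra.
by move: (N%:R ^+ k) (5 ^+ k : R) k5 => x y y0; field; rewrite gt_eqF.
Qed.

End Dimension.

(** * Charts of projective space *)

Section Charts.
Context {R : realType} {d : nat}.
Local Notation V := 'rV[R]_d.
Local Notation W := 'rV[R]_d.+1.
Implicit Types (x y tau : V) (p v : W) (i : 'I_d.+1) (e f : direction R d.+1).

(** A vector whose i-th coordinate is 1/4 and whose others are those of x - 1/2:
    with this scaling the compact box [1/4, 3/4]^d, well inside the unit cube, is
    enough to describe all directions whose largest coordinate is the i-th. *)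
Definition chart i x : W :=
  \row_k (if unlift i k is Some j then x 0 j - 1 / 2 else 1 / 4).

(** The linear map that carries the i-th chart to the i'-th one, translated by tau:
    see [shear_chart]. *)
Definition shear i i' tau p : W :=
  \row_k (if unlift i' k is Some j
          then p 0 (lift i j) + 4 * tau 0 j * p 0 i else p 0 i).

Lemma chartE i x : chart i x 0 i = 1 / 4.
Proof. by rewrite mxE unlift_none. Qed.

Lemma chart_lift i x j : chart i x 0 (lift i j) = x 0 j - 1 / 2.
Proof. by rewrite mxE liftK. Qed.

Lemma shear_chart i i' tau x : shear i i' tau (chart i x) = chart i' (x + tau).
Proof.
apply/rowP => k; rewrite [LHS]mxE [RHS]mxE; case: unliftP => [j _|_].
  by rewrite chart_lift chartE !mxE; field.
by rewrite chartE.
Qed.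

Lemma shearD i i' tau p q : shear i i' tau (p + q) = shear i i' tau p + shear i i' tau q.
Proof.
by apply/rowP => k; rewrite !mxE; case: unliftP => [j _|_]; rewrite ?mxE; ring.
Qed.

Lemma shearZ i i' tau t p : shear i i' tau (t *: p) = t *: shear i i' tau p.
Proof.
by apply/rowP => k; rewrite !mxE; case: unliftP => [j _|_]; rewrite ?mxE; ring.
Qed.

Lemma norm_shear i i' tau p : `|shear i i' tau p| <= (1 + 4 * `|tau|) * `|p|.
Proof.
apply: norm_le_coord => [|k]; first by rewrite mulr_ge0// addr_ge0// mulr_ge0.
rewrite mxE; case: unliftP => [j _|_]; last first.
  by rewrite (le_trans (coord_le_norm _ _))// ler_peMl// lerDl mulr_ge0.
rewrite [leRHS]mulrDl mul1r; apply: (le_trans (ler_normD _ _)).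
apply: lerD; first exact: coord_le_norm.
rewrite !normrM ger0_norm//.
by rewrite ler_pM ?mulr_ge0 ?coord_le_norm// ler_pM2l ?coord_le_norm.
Qed.

Lemma norm_shearB i i' tau tau' p :
  `|shear i i' tau p - shear i i' tau' p| <= 4 * `|tau - tau'| * `|p|.
Proof.
apply: norm_le_coord => [|k]; first by rewrite !mulr_ge0.
rewrite !mxE; case: unliftP => [j _|_]; last by rewrite subrr normr0 !mulr_ge0.
rewrite (_ : _ - _ = 4 * (tau - tau') 0 j * p 0 i); last by rewrite !mxE; ring.
rewrite !normrM ger0_norm//.
by rewrite ler_pM ?mulr_ge0 ?coord_le_norm// ler_pM2l ?coord_le_norm.
Qed.

Lemma norm_chartB i x y : `|chart i x - chart i y| <= `|x - y|.
Proof.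
apply: norm_le_coord => // k; rewrite !mxE; case: unliftP => [j _|_].
  by rewrite (_ : _ - _ = (x - y) 0 j) ?coord_le_norm// !mxE; ring.
by rewrite subrr normr0.
Qed.

Lemma norm_chart_le i x : `|chart i x| <= `|x| + 1.
Proof.
apply: norm_le_coord => [|k]; first by rewrite addr_ge0.
rewrite mxE; case: unliftP => [j _|_].
  rewrite (le_trans (ler_normB _ _))// lerD ?coord_le_norm// ger0_norm; lra.
by rewrite ger0_norm; have := normr_ge0 x; lra.
Qed.

Lemma norm_chart_ge i x : 1 / 4 <= `|chart i x|.
Proof. by have := coord_le_norm (chart i x) i; rewrite chartE ger0_norm//; lra. Qed.

Lemma chart_neq0 i x : chart i x != 0.
Proof. by rewrite -normr_gt0 (lt_le_trans _ (norm_chart_ge i x))//; lra. Qed.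

Lemma chart_dir_subproof i x : \dim <[chart i x]>%VS == 1%N.
Proof. by rewrite dim_vline chart_neq0. Qed.

Definition chart_dir i x : direction R d.+1 :=
  exist (fun U : {vspace W} => \dim U == 1%N) <[chart i x]>%VS (chart_dir_subproof i x).

Lemma line_chart_dir i x : line_of (chart_dir i x) = <[chart i x]>%VS.
Proof. by []. Qed.

Lemma line_of_inj e f : line_of e = line_of f -> e = f.
Proof. exact: val_inj. Qed.

Definition box : set V := [set x : V | forall j, 1 / 4 <= x 0 j <= 3 / 4].

(** Divide by the coordinate of largest absolute value. *)
Lemma chart_surj e : exists i x, box x /\ e = chart_dir i x.
Proof.
pose u := unit_of e.
have [i _ imax] := @arg_maxP _ _ 'I_d.+1 ord0 predT (fun k => `|u 0 k|) isT.
have ui : u 0 i != 0.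
  apply/eqP => ui; have := enorm_unit_of e; rewrite -/u.
  have -> : u = 0.
    apply/rowP => k; rewrite [RHS]mxE.
    by have /= := imax k isT; rewrite ui normr0 Num.Theory.normr_le0 => /eqP.
  by rewrite -(scale0r (0 : W)) enormZ normr0 mul0r => /eqP; rewrite eq_sym oner_eq0.
exists i, (\row_j (u 0 (lift i j) / (4 * u 0 i) + 1 / 2)); split.
  move=> j; rewrite mxE.
  have : `|u 0 (lift i j) / (4 * u 0 i)| <= 1 / 4.
    rewrite invfM mulrCA normrM ger0_norm ?invr_ge0// mul1r ler_piMr ?invr_ge0//.
    by rewrite normrM normfV ler_pdivrMr ?normr_gt0// mul1r; exact: imax.
  by rewrite ler_norml => /andP[? ?]; apply/andP; split; lra.
apply: line_of_inj; rewrite line_chart_dir line_ofE -/u.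
have -> : chart i (\row_j (u 0 (lift i j) / (4 * u 0 i) + 1 / 2)) = (4 * u 0 i)^-1 *: u.
  apply/rowP => k; rewrite [LHS]mxE [RHS]mxE; case: unliftP => [j ->|->].
    by rewrite [in LHS]mxE addrK mulrC.
  by field.
have c0 : (4 * u 0 i)^-1 != 0 by rewrite invr_eq0 mulf_neq0// pnatr_eq0.
apply/eqP; rewrite eqEsubv -!memvE; apply/andP; split; last by rewrite memvZ ?memv_line.
by have := memvZ (4 * u 0 i)^-1^-1 (memv_line ((4 * u 0 i)^-1 *: u)); rewrite scalerK.
Qed.

End Charts.

Section Angles.
Context {R : realType} {n : nat}.
Implicit Types (e f : direction R n) (a b u v : 'rV[R]_n).

Lemma unit_of_span e a : a != 0 -> line_of e = <[a]>%VS ->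
  exists s, unit_of e = s *: a /\ `|s| * enorm a = 1.
Proof.
move=> a0 ea; have : unit_of e \in line_of e by rewrite line_ofE memv_line.
rewrite ea => /vlineP[s us]; exists s; split=> //.
by rewrite -enormZ -us enorm_unit_of.
Qed.

(** If cos t >= 1/2, the mean value theorem gives sin t >= t / 2; otherwise
    sin t >= 1/2, and t <= pi / 2 < 2. *)
Lemma angle_le_sin (t : R) : 0 <= t <= pi / 2 -> t <= 4 * sin t.
Proof.
move=> /andP[t0 tpi]; have [->|tn0] := eqVneq t 0; first by rewrite sin0 mulr0.
have tp : 0 < t by rewrite lt_neqAle eq_sym tn0.
have pi2 := pihalf_lt2 R.
have s0 : 0 <= sin t by rewrite sin_ge0_pi// t0; have := pi_ge0 R; lra.
have [c c01 tc] : exists2 c, c \in `]0, t[ & sin t - sin 0 = cos c * (t - 0).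
  apply: MVT => //.
  by apply: continuous_subspaceT; exact: continuous_sin.
move: c01; rewrite in_itv/= => /andP[c0 ct].
rewrite sin0 !subr0 in tc.
have cc : cos t <= cos c.
  by rewrite ltW// ltr_cos// in_itv/= ?ltW//; have := pi_ge0 R; lra.
have [h|h] := leP (1 / 2) (cos t).
  by rewrite tc; nra.
have ct0 : 0 <= cos t by rewrite cos_ge0_pihalf// tpi andbT; lra.
have := cos2Dsin2 t; nra.
Qed.

(** The sine of the angle times the length of b is the distance of b to the line
    of a, which is at most the distance of b to a. *)
Lemma angle_le e f a b : a != 0 -> b != 0 -> line_of e = <[a]>%VS ->
  line_of f = <[b]>%VS -> angle e f <= 4 * enorm (b - a) / enorm b.
Proof.
move=> a0 b0 ea fb.
have [s [us sa]] := unit_of_span a0 ea; have [t [ut tb]] := unit_of_span b0 fb.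
have ep (c : 'rV[R]_n) : c != 0 -> 0 < enorm c.
  by move=> c0; rewrite lt_neqAle enorm_ge0 andbT eq_sym; apply: contra_neq c0; exact: enorm_eq0.
have ap := ep _ a0; have bp := ep _ b0.
have h := @angle_le_sin (angle e f) _.
apply: (le_trans (h _)); first by rewrite angle_ge0 angle_le_pihalf.
rewrite -mulrA ler_pM2l// ler_pdivlMr//.
have s0 : 0 <= sin (angle e f).
  rewrite sin_ge0_pi// angle_ge0/= (le_trans (angle_le_pihalf _ _))//.
  by have := pi_ge0 R; lra.
rewrite -(ler_pXn2r (n := 2)) ?nnegrE ?mulr_ge0 ?enorm_ge0//.
rewrite exprMn sin2cos2 cos_angle us ut dotZl dotZr real_normK ?num_real//.
have s2 : s ^+ 2 * dot a a = 1 by rewrite -sqr_enorm -[s ^+ 2]real_normK ?num_real// -exprMn sa expr1n.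
have t2 : t ^+ 2 * dot b b = 1 by rewrite -sqr_enorm -[t ^+ 2]real_normK ?num_real// -exprMn tb expr1n.
rewrite !sqr_enorm !(dotBl, dotBr) (dotC b a).
have a2 : 0 < dot a a by rewrite -sqr_enorm exprn_gt0.
rewrite (_ : _ * dot b b = dot b b - dot a b ^+ 2 * s ^+ 2 * (t ^+ 2 * dot b b)); last by ring.
rewrite t2 mulr1.
rewrite -subr_ge0 -(pmulr_rge0 _ a2).
rewrite [leRHS](_ : _ * _ = dot a a * (dot a a - 2 * dot a b) + dot a b ^+ 2 * (s ^+ 2 * dot a a)); last by ring.
rewrite s2 mulr1 (_ : _ + _ = (dot a a - dot a b) ^+ 2); last by ring.
exact: sqr_ge0.
Qed.

Lemma dot_sign_sub u v : dot u u = 1 -> dot v v = 1 ->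
  exists2 s : R, `|s| = 1 & dot (v - s *: u) (v - s *: u) = 2 - 2 * `|dot u v|.
Proof.
move=> uu vv; exists (if 0 <= dot u v then 1 else -1).
  by case: ifP; rewrite ?normrN1 ?normr1.
rewrite !(dotBl, dotBr, dotZl, dotZr) uu vv (dotC v).
case: ifPn => c0; first by rewrite ger0_norm//; ring.
by rewrite ltr0_norm ?ltNge//; ring.
Qed.

(** The vector unit_of e is determined up to its sign only, hence the factor s. *)
Lemma unit_of_close (r : R) : 0 < r -> exists2 del, 0 < del &
  forall e f, angle e f < del ->
  exists2 s : R, `|s| = 1 & enorm (unit_of f - s *: unit_of e) < r.
Proof.
move=> r0; have r2 : 0 < r ^+ 2 / 2 by rewrite divr_gt0// exprn_gt0.
have /cvgrPdist_lt/(_ _ r2) : cos x @[x --> (0:R)] --> cos (0:R) by exact: continuous_cos.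
move=> /nbhs_ballP[del /= del0 h]; exists del => // e f ef.
have := h (angle e f); rewrite /= -ball_normE/= sub0r normrN ger0_norm ?angle_ge0//.
move=> /(_ ef); rewrite cos0 cos_angle => h1.
have [s s1 sE] := dot_sign_sub (dot_unit_of e) (dot_unit_of f).
exists s => //; rewrite -(ltr_pXn2r (n := 2)) ?nnegrE ?enorm_ge0 ?(ltW r0)//.
rewrite sqr_enorm sE.
by move: (ler_norm (1 - `|dot (unit_of e) (unit_of f)|)); lra.
Qed.

Lemma segment_close (l r : R) : 0 <= l -> 0 < r -> exists2 del, 0 < del &
  forall p q e f, edist p q < del -> angle e f < del ->
  forall x, segment q f l%:E x -> exists2 y, segment p e l%:E y & edist x y < r.
Proof.
move=> l0 r0; have r1 : 0 < r / (l + 2) by rewrite divr_gt0//; lra.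
have [del del0 h] := unit_of_close r1.
exists (Num.min del (r / (l + 2))); first by rewrite lt_min del0.
move=> p q e f; rewrite !lt_min => /andP[_ pq] /andP[/h[s s1 ef] _] x.
rewrite segment_fin => -[t /= tl <-]; exists (p + (t * s) *: unit_of e).
  by rewrite segment_fin; exists (t * s) => //=; rewrite normrM s1 mulr1.
rewrite /edist (_ : q + t *: unit_of f - (p + (t * s) *: unit_of e) =
    (q - p) + t *: (unit_of f - s *: unit_of e)); last first.
  move: (unit_of e) (unit_of f) => u v.
  by rewrite scalerBr scalerA opprD addrACA.
rewrite (le_lt_trans (enormD _ _))// enormZ -/(edist q p) edist_sym.
have : `|t| * enorm (unit_of f - s *: unit_of e) <= l / 2 * (r / (l + 2)).
  by apply: ler_pM => //; [exact: enorm_ge0|exact: ltW].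
suff : r = 2 * (l / 2 * (r / (l + 2)) + r / (l + 2)).
  have : 0 <= l / 2 * (r / (l + 2)) by rewrite mulr_ge0 ?(ltW r1)// divr_ge0.
  by move: pq; lra.
by field; rewrite gt_eqF//; lra.
Qed.

Lemma compact_segment (p : 'rV[R]_n) e (l : R) : compact (segment p e l%:E).
Proof.
rewrite segment_fin.
have -> : [set t : R | `|t| <= l / 2] = `[- (l / 2), l / 2]%classic.
  by apply/seteqP; split=> t; rewrite /= in_itv/= ler_norml.
apply: continuous_compact; last exact: segment_compact.
apply: continuous_subspaceT => t; apply: cvgD; first exact: cvg_cst.
exact: scalel_continuous.
Qed.

End Angles.

(** * Spreading segments over all directions *)

Section Spread.
Context {R : realType}.

(** The gap between w and d - u absorbs all constants once the base is large. *)
Lemma choose_base (d : nat) (u w : R) : u <= d%:R -> d%:R - u < w ->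
  exists M' K : nat, [/\ (0 < M')%N, (0 < K)%N,
    4 * M'.+1%:R `^ (- u) * (M'.*2.+1 ^ d)%:R <= K%:R & K%:R <= M'.+1%:R `^ w].
Proof.
move=> ud duw; pose kap := w - (d%:R - u); have kap0 : 0 < kap by rewrite subr_gt0.
(* Half of T bounds 4 (2 M' + 1)^d / M^d, and the other half absorbs the
   rounding of M^w to the integer K. *)
pose T : R := 8 * 2 ^+ d.
have T1 : 8 <= T by rewrite ler_peMr// exprn_ege1// ler1n.
pose M' := (Num.truncn (T `^ kap^-1)).+1.
exists M', (Num.truncn (M'.+1%:R `^ w : R)).
set M : R := M'.+1%:R; have M1 : 1 <= M by rewrite ler1n.
have Mk : T <= M `^ kap.
  rewrite -[leLHS]powRr1; last by lra.
  rewrite -(mulVf (lt0r_neq0 kap0)) powRrM ge0_ler_powR ?nnegrE ?powR_ge0 ?ltW//.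
  by rewrite (lt_trans (truncnS_gt _))// ltr_nat.
have M2 : 1 <= M `^ (d%:R - u).
  by rewrite -[leLHS](powRr0 M) ler_powR// subr_ge0.
have Mw : M `^ w = M `^ kap * M `^ (d%:R - u).
  by rewrite -powRD ?subrK// pnatr_eq0 implybT.
have w0 : 0 <= M `^ w by exact: powR_ge0.
have /andP[K1 K2] := truncn_itv w0.
rewrite -/M; set K := Num.truncn _ in K1 K2 *.
have big : 4 * 2 ^+ d * M `^ (d%:R - u) + 1 <= M `^ w.
  have : T * M `^ (d%:R - u) <= M `^ w by rewrite Mw ler_pM2r// (lt_le_trans ltr01).
  have : 1 <= (2 : R) ^+ d by rewrite exprn_ege1// ler1n.
  by rewrite /T; nra.
split=> //.
  rewrite -(ltr_nat R); have : 1 <= (2 : R) ^+ d by rewrite exprn_ege1// ler1n.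
  by move: K2; rewrite -natr1; nra.
apply: (@le_trans _ _ (4 * 2 ^+ d * M `^ (d%:R - u))); last first.
  by move: K2; rewrite -natr1; lra.
rewrite -!mulrA ler_pM2l// powRD ?pnatr_eq0 ?implybT// powR_mulrn ?(le_trans ler01)//.
rewrite [leRHS]mulrA (mulrC (M `^ _)) ler_pM2r ?powR_gt0 ?(lt_le_trans ltr01)//.
rewrite natrX -exprMn lerXn2r ?nnegrE ?mulr_ge0 ?(le_trans ler01 M1)//.
by rewrite -natrM ler_nat mul2n doubleS ltnW.
Qed.

Lemma scale_of_radius (M' : nat) (r : R) : (0 < M')%N -> 0 < r <= 1 ->
  exists j, r <= @mesh R M' j <= M'.+1%:R * r.
Proof.
move=> M'0 /andP[r0 r1].
have ex : exists j, @mesh R M' j < r by exact: mesh_small.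
have [[|j] jr jmin] := ex_minnP ex; first by move: jr; rewrite mesh0 ltNge r1.
exists j; rewrite -{2}meshS ler_pM2l ?ltr0n// (ltW jr) andbT leNgt.
by apply/negP => /jmin; rewrite ltnn.
Qed.

End Spread.

Section ThickPiece.
Context {R : realType} {d : nat}.
Local Notation V := 'rV[R]_d.
Local Notation W := 'rV[R]_d.+1.
Variables (u s sigma : R).
Hypotheses (d0 : (0 < d)%N) (ud : u <= d%:R) (s0 : 0 < s)
  (sigma_big : d%:R - u < sigma - s).

(** Each ball of radius r of a cover of E is replaced by its images under lam times
    the shears by the m K^j approximate translations at the scale j with
    M^-j close to r.  As K <= M^(sigma - s), this multiplies the cost by a
    constant C2 that is known before the cover of E is chosen.  The shears used
    have norm at most 13 because only translations of norm below 3 occur. *)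
Lemma spread_lines (A : set V) (E : set W) (i i' : 'I_d.+1) (q : W) (a r0 : R) :
  0 < a -> 0 < r0 -> A `<=` @cube R d 0 0 0 -> ~ null u A -> null s E ->
  (forall x, A x -> exists2 p, `|p - q| < r0 &
    forall t, `|t| <= a -> E (p + t *: chart i x)) ->
  forall lam eta, 0 < lam -> 0 < eta -> exists2 F, economical sigma eta F &
    forall y, @cube R d 0 0 0 y -> exists2 p, `|p| < lam * (13 * r0) &
      forall t, `|t| <= lam * a -> covered F (p + t *: chart i' y).
Proof.
move=> a0 r00 A0 nA nE AE lam eta lam0 eta0.
have [M' [K [M'0 K0 Kbig Kw]]] := choose_base ud sigma_big.
have [c c0 Ac] := not_null_content nA.
have [m hm] := few_translations d0 M'0 ud c0 Kbig K0.
pose meshM := @mesh R M'; pose M : R := M'.+1%:R; have M0 : 0 < M by rewrite ltr0n.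
pose R0 := r0 + 3 * a + 1.
have R00 : 0 < R0 by rewrite /R0; lra.
pose Lam := lam * (14 + 4 * R0).
have Lam0 : 0 < Lam by rewrite mulr_gt0// addr_gt0// mulr_gt0.
pose C2 := m%:R * Lam `^ sigma * M `^ s + 1.
have C20 : 0 < C2 by rewrite ltr_wpDl// !mulr_ge0// powR_ge0.
pose e := Num.min 1 (eta / C2).
have e0 : 0 < e by rewrite lt_min ltr01 divr_gt0.
have [F Fe EF] := nE e e0.
(* The bound on x is only there to bound the translations that are used. *)
pose G := [set x : V | `|x| < 2 /\ exists2 p, `|p - q| < r0 &
    forall t, `|t| <= a -> covered F (p + t *: chart i x)].
have oG : open G.
  rewrite openE => x [x2 [p pq pF]]; apply/nbhs_ballP.
  pose S := [set p + t *: chart i x | t in `[- a, a]%classic].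
  have cS : compact S.
    apply: continuous_compact; last exact: segment_compact.
    apply: continuous_subspaceT => t; apply: cvgD; first exact: cvg_cst.
    exact: scalel_continuous.
  have SF : S `<=` covered F.
    by move=> _ [t + <-]; rewrite /= in_itv/= => ta; apply: pF; rewrite ler_norml.
  have [r rr0 rF] := compact_open_nbhd cS (@open_covered _ _ F) SF.
  exists (Num.min (2 - `|x|) (r / a)); first by rewrite /= lt_min subr_gt0 x2 divr_gt0.
  move=> y; rewrite -ball_normE/= lt_min => /andP[xy1 xy2]; split.
    rewrite -(subrK x y) (le_lt_trans (ler_normD _ _))// distrC.
    by move: xy1; clear - d0 ud s0 sigma_big; lra.
  exists p => // t ta; apply: (rF (p + t *: chart i x)).
    by exists t => //; rewrite /= in_itv/= -ler_norml.
  rewrite opprD addrACA subrr add0r -scalerBr normrZ.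
  apply: (@le_lt_trans _ _ (a * `|x - y|)).
    by rewrite ler_pM// norm_chartB.
  by rewrite mulrC -ltr_pdivlMr.
have AG : A `<=` G.
  move=> x Ax; split.
    have := cube_norm (A0 _ Ax); rewrite subr0 mesh0 => /lt_trans; apply; clear - d0 ud s0 sigma_big; lra.
  by have [p pq pE] := AE x Ax; exists p => // t ta; apply: EF; exact: pE.
have [C [CG CL]] := hm A G oG AG A0 Ac.
have /choice[Lj LjP] j : exists L : seq V, (size L <= m * K ^ j)%N /\
    forall t, t \in C -> exists2 l, l \in L & `|t - l| <= meshM j.
  by have [L ? ?] := CL j; exists L.
have /choice[J JP] (r : R) : exists j, 0 < r <= 1 -> r <= meshM j <= M * r.
  have [h|h] := boolP (0 < r <= 1); last by exists 0%N.
  by have [j ?] := scale_of_radius M'0 h; exists j.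
pose F1 (b : W * R) := [seq (lam *: shear i i' t (b.1 - q), Lam * meshM (J b.2)) | t <- Lj (J b.2)].
pose F' l := flatten [seq F1 b | b <- F l].
have rad l b : b \in F l -> 0 < b.2 <= 1.
  move=> bl; rewrite (Fe.1 _ _ bl)/=; apply: (powR_le_inv s0) => //.
    exact/ltW/(Fe.1 _ _ bl).
  by rewrite powR1 (le_trans (economical_radius Fe bl))// /e ge_min lexx.
have F1w l b : b \in F l -> weight sigma (F1 b) <= C2 * b.2 `^ s.
  move=> bl; have b01 := rad _ _ bl; have /andP[b0 b1] := b01.
  rewrite /weight big_map /= big_const_seq count_predT iter_addr_0 /=.
  set j := J b.2; have /andP[j1 j2] := JP _ b01; rewrite -/j in j1 j2.
  have mj : 0 < meshM j := @mesh_gt0 R M' j.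
  apply: (@le_trans _ _ (m%:R * K%:R ^+ j * (Lam * meshM j) `^ sigma)).
    rewrite -[leLHS]mulr_natl ler_wpM2r ?powR_ge0//.
    by rewrite -natrX -natrM ler_nat; exact: (LjP j).1.
  apply: (@le_trans _ _ (m%:R * Lam `^ sigma * M `^ s * b.2 `^ s)); last first.
    by rewrite ler_wpM2r ?powR_ge0// lerDl.
  rewrite powRM ?(ltW Lam0) ?(ltW mj)//.
  rewrite [leLHS](_ : _ = m%:R * Lam `^ sigma * (K%:R ^+ j * meshM j `^ sigma)); last by ring.
  rewrite -[leRHS]mulrA ler_wpM2l ?mulr_ge0 ?powR_ge0//.
  rewrite -powRM ?(ltW M0) ?(ltW b0)//.
  apply: (@le_trans _ _ (meshM j `^ s)); last first.
    by rewrite ge0_ler_powR ?nnegrE ?(ltW s0) ?(ltW mj) ?mulr_ge0 ?(ltW M0) ?(ltW b0).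
  apply: (@le_trans _ _ ((M `^ (sigma - s)) ^+ j * meshM j `^ sigma)).
    by rewrite ler_wpM2r ?powR_ge0// lerXn2r ?nnegrE ?powR_ge0.
  rewrite /meshM /mesh -/M -powR_mulrn ?powR_ge0// -powR_invn ?(ltW M0)// -!powRrM -powRD; last first.
    by rewrite pnatr_eq0 implybT.
  by rewrite le_eqVlt; apply/orP; left; apply/eqP; congr powR; ring.
exists F'.
  split=> [l b /flattenP[_ /mapP[b' bl ->] /mapP[t _ ->]]/=|L].
    by rewrite mulr_gt0// mesh_gt0.
  apply: (@le_trans _ _ (\sum_(l < L) C2 * weight s (F l))).
    apply: ler_sum => l _; rewrite /weight big_flatten big_map mulr_sumr.
    by rewrite big_seq [leRHS]big_seq; apply: ler_sum => b; exact: F1w.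
  rewrite -mulr_sumr (le_trans (ler_wpM2l (ltW C20) (Fe.2 L)))//.
  by rewrite mulrC -ler_pdivlMr// /e ge_min lexx orbT.
move=> y y0; have [tau tC [yt2 [p pq pF]]] := CG y y0.
have tau3 : `|tau| < 3.
  have := cube_norm y0; rewrite subr0 mesh0 => y1.
  have := ler_normB y (y - tau); rewrite opprB addrC subrK.
  by move: y1 yt2; clear - d0 ud s0 sigma_big; lra.
have shear13 v : `|shear i i' tau v| <= 13 * `|v|.
  by rewrite (le_trans (norm_shear _ _ _ _))// ler_wpM2r//; move: tau3; clear - d0 ud s0 sigma_big; lra.
exists (lam *: shear i i' tau (p - q)).
  rewrite normrZ gtr0_norm// ltr_pM2l//.
  by rewrite (le_lt_trans (shear13 _))// ltr_pM2l.
move=> t tla; pose t' := t / lam.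
have t'a : `|t'| <= a by rewrite normrM normfV (gtr0_norm lam0) ler_pdivrMr// mulrC.
have [l [b bl wb]] := pF t' t'a.
have b01 := rad _ _ bl; have /andP[b0 b1] := b01.
have /andP[j1 j2] := JP _ b01.
have [t0 t0L tt0] := (LjP (J b.2)).2 _ tC.
exists l, (lam *: shear i i' t0 (b.1 - q), Lam * meshM (J b.2)).
  apply/flattenP; exists (F1 b); first exact: map_f.
  by apply/mapP; exists t0.
rewrite /=; set w := p + t' *: chart i (y - tau) in wb.
have -> : lam *: shear i i' tau (p - q) + t *: chart i' y =
    lam *: shear i i' tau (w - q).
  have -> : w - q = (p - q) + t' *: chart i (y - tau) by rewrite /w addrAC.
  rewrite [in RHS](shearD i i' tau (p - q)) shearZ shear_chart subrK scalerDr scalerA.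
  by rewrite /t' mulrCA mulfV ?mulr1// gt_eqF.
rewrite -scalerBr normrZ gtr0_norm// /Lam -mulrA ltr_pM2l//.
rewrite -(subrKA b.1 w (- q)) [shear _ _ tau _]shearD -[_ + _ - _]addrA.
rewrite (le_lt_trans (ler_normD _ _))//.
have mj : 0 < meshM (J b.2) := @mesh_gt0 R M' _.
have wq : `|w - q| < r0 + 3 * a.
  rewrite /w addrAC (le_lt_trans (ler_normD _ _))//.
  apply: ltr_leD => //; rewrite normrZ mulrC ler_pM//.
  by rewrite (le_trans (norm_chart_le _ _))//; move: yt2; clear - d0 ud s0 sigma_big; lra.
have bq : `|b.1 - q| <= R0.
  rewrite -(subrKA w) (le_trans (ler_normD _ _))// distrC.
  by rewrite /R0; move: wq wb b1; clear - d0 ud s0 sigma_big; lra.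
have h1 : `|shear i i' tau (w - b.1)| < 13 * meshM (J b.2).
  by rewrite (le_lt_trans (shear13 _))// ltr_pM2l// (lt_le_trans wb).
have h2 : `|shear i i' tau (b.1 - q) - shear i i' t0 (b.1 - q)| <= 4 * meshM (J b.2) * R0.
  rewrite (le_trans (norm_shearB _ _ _ _ _))//.
  by rewrite ler_pM ?mulr_ge0// ler_pM2l.
by move: h1 h2 mj; clear - d0 ud s0 sigma_big; lra.
Qed.

End ThickPiece.

(** * Thick sets of directions *)

Section Thick.
Context {R : realType} {d : nat}.
Local Notation V := 'rV[R]_d.
Local Notation W := 'rV[R]_d.+1.
Implicit Types (D : set (direction R d.+1)) (u s sigma : R).

Definition chart_set D (i : 'I_d.+1) : set V :=
  [set x | @cube R d 0 0 0 x /\ D (chart_dir i x)].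

(** D has positive u-dimensional Hausdorff measure in some chart. *)
Definition thick u D := exists i, ~ null u (chart_set D i).

Lemma box_cube : @box R d `<=` @cube R d 0 0 0.
Proof.
by move=> x bx i; have := bx i; rewrite mesh0 mxE => /andP[? ?]; apply/andP; split; lra.
Qed.

(** The unit cube is u-null for u > d. *)
Lemma thick_le u D : thick u D -> u <= d%:R.
Proof.
move=> [i nD]; rewrite leNgt; apply/negP => du; apply: nD.
by apply: null_sub (null_cube du) => x [+ _] k => /(_ k); rewrite !mesh0.
Qed.

Lemma thick_full : thick d%:R [set: direction R d.+1].
Proof.
exists ord0 => nC; apply: (@not_null_box R d); apply: null_sub nC => x bx.
by split=> //; exact: box_cube.
Qed.

Lemma thick0 D : D !=set0 -> thick 0 D.
Proof.
move=> [e De]; have [i [x [bx ex]]] := chart_surj e.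
exists i => /null0_set0 h; have : chart_set D i x.
  by split; [exact: box_cube|rewrite -ex].
by rewrite h.
Qed.

Lemma chart_dir_lip : exists2 c : R, 0 < c & forall i (x y : V),
  angle (chart_dir i x) (chart_dir i y) <= c * `|x - y|.
Proof.
have c0 : 0 < Num.sqrt d.+1%:R + 1 :> R by rewrite ltr_wpDl ?sqrtr_ge0.
exists (16 * (Num.sqrt d.+1%:R + 1)); first by rewrite mulr_gt0.
move=> i x y.
have yge : 1 / 4 <= enorm (chart i y).
  exact: le_trans (norm_chart_ge i y) (norm_le_enorm _).
have h := angle_le (chart_neq0 i x) (chart_neq0 i y) (line_chart_dir i x) (line_chart_dir i y).
apply: (le_trans h); rewrite ler_pdivrMr; last by lra.
have h2 : enorm (chart i y - chart i x) <= (Num.sqrt d.+1%:R + 1) * `|x - y|.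
  rewrite (le_trans (edist_le_norm _ _))// ler_pM2l// distrC.
  exact: norm_chartB.
have : 0 <= (Num.sqrt d.+1%:R + 1) * `|x - y| by rewrite mulr_ge0 ?(ltW c0).
by move: h2; rewrite -mulrA; nra.
Qed.

Lemma thick_of_dim u D : 0 < u -> (u%:E < dimH_dir D)%E -> thick u D.
Proof.
move=> u0 uD; apply: contrapT => /forallNP nD.
have {}nD i : null u (chart_set D i) by exact: contrapT (nD i).
move: uD; apply/negP; rewrite -leNgt; apply: ge_ereal_inf; exists u%:E => //.
exists u => //; split; first exact: ltW.
have [c c0 cl] := chart_dir_lip.
apply: (@null_hausdorff_measure R d _ angle (@angle_ge0 R d.+1) 'I_d.+1 u c
  (chart_set D) D (fun i x e => e = chart_dir i x)) => //.
  by move=> i x y e f -> ->; exact: cl.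
move=> e De; have [i [x [bx ex]]] := chart_surj e; exists i, x => //.
by split; [exact: box_cube|rewrite -ex].
Qed.

(** For fixed L and rho, the directions in D are sorted into countably many classes
    according to a lower bound 1 / (m + 1) for the length of the segment and to a
    point of a lattice near its midpoint; the step r m of the lattice is chosen
    so small that it remains below rho after scaling to the length L.  One of
    the classes is not null, and [spread_lines] applies to it. *)
Lemma thick_segments u s sigma (D : set (direction R d.+1)) (E : set W) :
  (0 < d)%N -> thick u D -> 0 < s -> null s E -> segment_in_directions D E ->
  d%:R - u < sigma - s ->
  forall eta rho L, 0 < eta -> 0 < rho -> 0 < L ->
  exists2 F, economical sigma eta F & forall e : direction R d.+1,
    exists2 p, `|p| < rho & segment p e L%:E `<=` covered F.
Proof.
move=> d0 uD s0 nE DE sig eta rho L eta0 rho0 L0.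
have ud := thick_le uD; have [i nD] := uD.
pose a m : R := m.+1%:R^-1; pose lam m : R := 2 * L * m.+1%:R.
have a0 m : 0 < a m by rewrite invr_gt0.
have lam0 m : 0 < lam m by rewrite !mulr_gt0.
pose r m := rho / (13 * lam m).
have r0 m : 0 < r m by rewrite divr_gt0// mulr_gt0.
pose A (mz : nat * 'rV[int]_d.+1) : set V := [set x | chart_set D i x /\
  exists2 p, `|p - r mz.1 *: map_mx intr mz.2| < r mz.1 &
    forall t, `|t| <= a mz.1 -> E (p + t *: chart i x)].
have [mz nA] : exists mz, ~ null u (A mz).
  apply: contrapT => /forallNP h; apply: nD.
  apply: (@null_sub _ _ _ _ (\bigcup_mz A mz)); last first.
    by apply: null_bigcup_countable => mz; exact: contrapT (h mz).
  move=> x Dx; have [p [l [l0 pl]]] := DE _ Dx.2.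
  pose m := Num.truncn (2 * enorm (chart i x) / l).
  have am : a m * enorm (chart i x) <= l / 2.
    rewrite mulrC ler_pdivrMr//.
    have := truncnS_gt (2 * enorm (chart i x) / l); rewrite -/m ltr_pdivrMr//.
    by lra.
  exists (m, \row_k Num.floor (p 0 k / r m)) => //; split=> //.
  exists p => [|t ta].
    apply: norm_lt_coord => // k; rewrite !mxE/=.
    have /andP[] := floor_itv (p 0 k / r m).
    rewrite ler_pdivlMr// ltr_pdivrMr// intrD mulrDl mul1r (mulrC _ (r m)) => h1 h2.
    by rewrite ger0_norm ?subr_ge0// ltrBlDl.
  apply: pl; split; rewrite (addrC p) addrK; first by rewrite line_chart_dir memvZ ?memv_line.
  rewrite -EFinM lee_fin enormZ (le_trans _ am)//.
  by rewrite ler_wpM2r ?enorm_ge0.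
have AE x : A mz x -> exists2 p, `|p - r mz.1 *: map_mx intr mz.2| < r mz.1 &
    forall t, `|t| <= a mz.1 -> E (p + t *: chart i x) by case.
have A0 : A mz `<=` @cube R d 0 0 0 by move=> x [[]].
have /choice[Fs Fse] (k : nat) : exists F, economical sigma (eta / 2 ^+ k.+1) F /\
    forall y, @cube R d 0 0 0 y -> exists2 p, `|p| < lam mz.1 * (13 * r mz.1) &
      forall t, `|t| <= lam mz.1 * a mz.1 -> covered F (p + t *: chart (inord k) y).
  have e0 : 0 < eta / 2 ^+ k.+1 by rewrite divr_gt0// exprn_gt0.
  have [F ? ?] := spread_lines d0 ud s0 sig (inord k) (a0 mz.1) (r0 mz.1) A0 nA nE AE
    (lam0 mz.1) e0.
  by exists F.
have [F Fe FsF] := economical_bigcup (fun i => (Fse i).1) (fun L => sum_half_le L (ltW eta0)).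
exists F => // e; have [i' [x [bx ->]]] := chart_surj e.
have [p pr pF] := (Fse i').2 x (box_cube bx).
exists p.
  have -> : rho = lam mz.1 * (13 * r mz.1); last by [].
  by rewrite /r; field; rewrite gt_eqF.
move=> y [+ yL]; rewrite line_chart_dir => /vlineP[t yt].
have yE : y = p + t *: chart i' x by rewrite -yt addrC subrK.
rewrite {}yE {yt} in yL *.
apply: (FsF i'); move: pF; rewrite inord_val; apply.
rewrite /lam /a mulfK//.
move: yL; rewrite (addrC p) addrK -EFinM lee_fin => yL.
have := le_trans (norm_le_enorm _) yL; rewrite normrZ.
have := norm_chart_ge i' x; have := normr_ge0 t; nra.
Qed.

End Thick.

(** * Topology of segments and directions *)

(** Apply near-coverings to the filter of the finite sequences in K that contain a
    given one. *)
Lemma compact_finite_net (X : topologicalType) (K : set X) (N : X -> set X) :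
  compact K -> (forall x, K x -> nbhs x (N x)) ->
  exists s : seq X, (forall y, y \in s -> K y) /\
    forall x, K x -> exists2 y, y \in s & N y x.
Proof.
move=> /compact_near_coveringP cK KN.
pose F : set_system (seq X) := fun A => exists s0 : seq X, (forall y, y \in s0 -> K y) /\
  forall t, {subset s0 <= t} -> (forall y, y \in t -> K y) -> A t.
have FF : Filter F.
  split; first by exists [::].
    move=> A B [s [sK sA]] [t [tK tB]]; exists (s ++ t); split.
      by move=> y; rewrite mem_cat => /orP[/sK|/tK].
    move=> v sv vK; split; [apply: sA|apply: tB] => // y ys; apply: sv;
    by rewrite mem_cat ys ?orbT.
  by move=> A B AB [s [sK sA]]; exists s; split=> // t st tK; apply/AB/sA.
pose P (t : seq X) (x : X) := exists2 y, y \in t & N y x.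
have [x Kx|s [sK sP]] := cK _ F P FF.
  exists (N x, [set t : seq X | x \in t]) => /=.
    split; first exact: KN.
    exists [:: x]; split=> [y|t]; first by rewrite inE => /eqP ->.
    by move=> xt _; apply: xt; rewrite mem_head.
  by move=> [y t] /= [Ny xt]; exists x.
by exists s; split=> //; exact: (sP s).
Qed.

Section PairTopology.
Context {R : realType} {n : nat}.
Local Notation X := ('rV[R]_n * direction R n)%type.
Implicit Types (K : set X) (x y z : X) (e f : direction R n).

Lemma ball_angle e r : ball e r = [set f | angle e f < r].
Proof. by rewrite ballEmdist. Qed.

Lemma edist_small (p : 'rV[R]_n) (r : R) : 0 < r -> \forall q \near p, edist p q < r.
Proof.
move=> r0; have c0 : 0 < Num.sqrt n%:R + 1 :> R by rewrite ltr_wpDl ?sqrtr_ge0.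
apply/nbhs_ballP; exists (r / (Num.sqrt n%:R + 1)); first by rewrite /= divr_gt0.
move=> q; rewrite -ball_normE/= ltr_pdivlMr// => pq.
by rewrite (le_lt_trans (edist_le_norm _ _))// mulrC.
Qed.

Lemma angle_small e (r : R) : 0 < r -> \forall f \near e, angle e f < r.
Proof. by move=> r0; apply/nbhs_ballP; exists r => //= f; rewrite ball_angle. Qed.

Lemma pdist_small x (r : R) : 0 < r -> \forall y \near x, pdist x y < r.
Proof.
move=> r0; exists ([set q | edist x.1 q < r], [set f | angle x.2 f < r]) => /=.
  by split; [exact: edist_small|exact: angle_small].
by move=> [q f] /= [h1 h2]; rewrite /pdist gt_max h1 h2.
Qed.

Lemma closed_compact_nbhd K (r : R) : compact K ->
  closed [set w : X | exists2 z, K z & pdist w z <= r].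
Proof.
move=> /compact_near_coveringP cK w clw; apply: contrapT => no.
have far z : K z -> r < pdist w z.
  by move=> Kz; rewrite ltNge; apply/negP => h; apply: no; exists z.
have h : \forall w' \near w, K `<=` (fun z => r < pdist w' z).
  apply: (cK X (nbhs w) (fun w' z => r < pdist w' z)) => z Kz.
  pose e := (pdist w z - r) / 2; have e0 : 0 < e by rewrite divr_gt0// subr_gt0 far.
  near=> z' w' => /=.
  have h1 : pdist w w' < e by near: w'; exact: pdist_small.
  have h2 : pdist z z' < e by near: z'; exact: pdist_small.
  have := le_trans (pdist_triangle w' w z) (lerD (lexx _) (pdist_triangle z' w' z)).
  by move: h1 h2; rewrite (pdist_sym z' z) /e; lra.
have [w' [[z Kz wz] /(_ z Kz)]] := clw _ h.
by rewrite ltNge wz.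
Unshelve. all: by end_near. Qed.

Lemma closed_direction e : closed [set w : X | w.2 = e].
Proof.
move=> w clw; apply: angle_eq0; apply/eqP; rewrite eq_le angle_ge0 andbT leNgt.
apply/negP => we.
have [w' [/= w'e]] := clw _ (pdist_small w we).
by rewrite /pdist gt_max w'e ltxx andbF.
Qed.

Lemma closed_angle e (r : R) : closed [set f : direction R n | angle e f <= r].
Proof.
move=> f clf /=; rewrite leNgt; apply/negP => rf.
have e0 : 0 < angle e f - r by rewrite subr_gt0.
have [g [/= eg]] := clf _ (angle_small f e0).
by have := angle_triangle g e f; rewrite (angle_sym g f); lra.
Qed.

(** For l finite, the segments depend continuously on (p, e) although unit_of does
    not. *)
Lemma segment_tube K (U : set 'rV[R]_n) (l : R) : 0 <= l -> compact K -> open U ->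
  (forall x, K x -> segment x.1 x.2 l%:E `<=` U) ->
  exists2 del, 0 < del & forall x y, K x -> pdist x y < del ->
    segment y.1 y.2 l%:E `<=` U.
Proof.
move=> l0 /compact_near_coveringP cK oU KU.
pose P (del : R) x := forall y, pdist x y < del -> segment y.1 y.2 l%:E `<=` U.
suff [e /= e0 h] : \forall del \near (0:R)^'+, K `<=` P del.
  exists (e / 2); first by rewrite divr_gt0.
  move=> x y Kx xy; apply: (h (e / 2)) xy => //=; last by rewrite divr_gt0.
  by rewrite sub0r normrN gtr0_norm ?divr_gt0//; lra.
apply: cK => x Kx.
have [r r0 rU] := compact_open_nbhd (@compact_segment R n x.1 x.2 l) oU (KU x Kx).
have [del del0 close] := @segment_close R n l r l0 r0.
have del2 : 0 < del / 2 by rewrite divr_gt0.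
near=> x' t => /= y x'y.
have xx' : pdist x x' < del / 2 by near: x'; exact: pdist_small.
have tdel : t < del / 2 by near: t; exact: nbhs_right_lt.
have : pdist x y < del by have := pdist_triangle x' x y; lra.
rewrite /pdist gt_max => /andP[h1 h2] z /(close _ _ _ _ h1 h2)[z' xz' zz'].
apply: (rU z') => //; apply: le_lt_trans (norm_le_enorm _) _.
by rewrite -/(edist z' z) edist_sym.
Unshelve. all: by end_near. Qed.

(** Being off a segment is an open condition on the point and the segment jointly. *)
Lemma not_segment_near (x z : 'rV[R]_n) e (l : R) : 0 <= l ->
  ~ segment x e l%:E z -> exists2 del : R, 0 < del & forall (x' : 'rV[R]_n) e' (z' : 'rV[R]_n),
    edist x x' < del -> angle e e' < del -> edist z z' < del ->
    ~ segment x' e' l%:E z'.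
Proof.
move=> l0 nz.
have cl : open (~` segment x e l%:E).
  by apply: closed_openC; apply: compact_closed (@compact_segment R n x e l); exact: norm_hausdorff.
have /nbhs_ballP[r /= r0 rN] := open_nbhs_nbhs (conj cl nz).
have [|del del0 close] := @segment_close R n l (r / 2) l0; first by rewrite divr_gt0.
exists (Num.min del (r / 2)); first by rewrite lt_min del0 divr_gt0.
move=> x' e' z'; rewrite !lt_min => /andP[h1 _] /andP[h2 _] /andP[_ h3] sz.
have [y sy yz] := close _ _ _ _ h1 h2 _ sz.
apply: (rN y) => //; rewrite -ball_normE/=; apply: le_lt_trans (norm_le_enorm _) _.
by have := edist_triangle z' z y; rewrite -/(edist z y); lra.
Qed.

Lemma segment_pinfty_trunc (p z : 'rV[R]_n) e (l : R) : edist z p <= l / 2 ->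
  segment p e +oo z <-> segment p e l%:E z.
Proof.
move=> zp; split=> -[ze _]; split=> //.
by rewrite gt0_mulye ?lte_fin ?invr_gt0// leey.
Qed.

(** Near a given point only a bounded part of a line matters, so that lines can be
    replaced by segments of finite length. *)
Lemma closed_segments (l : \bar R) K : (0 <= l)%E -> compact K -> closed (segments l K).
Proof.
move=> l0 /compact_near_coveringP cK z clz; apply: contrapT => nz.
have far x : K x -> ~ segment x.1 x.2 l z by move=> Kx sz; apply: nz; exists x.
pose P (z' : 'rV[R]_n) x := ~ segment x.1 x.2 l z'.
have h : \forall z' \near z, K `<=` P z'.
  have cK' := cK _ (nbhs z) P (nbhs_filter z).
  apply: cK' => x /far nx.
  rewrite /P; case: l l0 {nz far clz P} nx => [l| |//].
    rewrite lee_fin => l0 nx.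
    have [del del0 hdel] := not_segment_near l0 nx.
    near=> x' z' => /=.
    have : pdist x x' < del by near: x'; exact: pdist_small.
    rewrite /pdist gt_max => /andP[? ?]; apply: hdel => //.
    by near: z'; exact: edist_small.
  move=> _ nx; pose l := 2 * (edist z x.1 + 2).
  have l0 : 0 <= l by rewrite mulr_ge0// addr_ge0// edist_ge0.
  have nx' : ~ segment x.1 x.2 l%:E z.
    by rewrite -segment_pinfty_trunc// /l; have := edist_ge0 z x.1; lra.
  have [del del0 hdel] := not_segment_near l0 nx'.
  near=> x' z' => /=.
  have : pdist x x' < Num.min del 1 by near: x'; apply: pdist_small; rewrite lt_min del0 ltr01.
  rewrite /pdist gt_max !lt_min => /andP[/andP[h1 h2] /andP[h3 h4]].
  have zz : edist z z' < Num.min del 1.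
    by near: z'; apply: edist_small; rewrite lt_min del0 ltr01.
  move: zz; rewrite lt_min => /andP[h5 h6].
  rewrite (@segment_pinfty_trunc _ _ _ l); first exact: hdel.
  have := edist_triangle z z' x'.1; have := edist_triangle x.1 z x'.1.
  by rewrite (edist_sym z' z) /l; lra.
have [z' [[x Kx xz'] /(_ x Kx)]] := clz _ h.
exact.
Unshelve. all: by end_near. Qed.

End PairTopology.

Section CompactDirections.
Context {R : realType} {d : nat}.

Lemma chart_dir_continuous i : continuous (@chart_dir R d i).
Proof.
have [c c0 cl] := @chart_dir_lip R d.
move=> x A /nbhs_ballP[r /= r0 rA]; apply/nbhs_ballP.
exists (r / c); first by rewrite /= divr_gt0.
move=> y; rewrite -ball_normE/= ltr_pdivlMr// => xy; apply: rA.
by rewrite ball_angle/= (le_lt_trans (cl _ _ _))// mulrC.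
Qed.

Lemma compact_box : compact (@box R d).
Proof.
have := @rV_compact R d (fun=> `[1 / 4, 3 / 4]%classic) (fun=> @segment_compact R _ _).
congr compact; apply/seteqP; split=> x h i; have := h i; rewrite /= in_itv/=; exact.
Qed.

Lemma compact_directions : compact [set: direction R d.+1].
Proof.
have -> : [set: direction R d.+1] = \big[setU/set0]_(i < d.+1) (chart_dir i @` @box R d).
  apply/seteqP; split=> // e _; have [i [x [bx ->]]] := chart_surj e.
  by rewrite (bigD1 i)//=; left; exists x.
apply: bigsetU_compact => i _; apply: continuous_compact.
  by apply: continuous_subspaceT; exact: chart_dir_continuous.
exact: compact_box.
Qed.

End CompactDirections.

(** * The Baire property of the space of compact sets *)

Section KspaceBaire.
Context {R : realType} {d : nat}.
Local Notation X := ('rV[R]_d.+1 * direction R d.+1)%type.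
Local Notation C := (@unit_cube R d.+1).
Local Notation KS := (Kspace C [set: direction R d.+1]).
Implicit Types (K L : KS) (x y z : X).

Lemma KspaceP K : [/\ \val K `<=` C `*` setT, compact (\val K) & snd @` (\val K) = setT].
Proof. exact: set_mem (valP K). Qed.

Lemma Kspace_full K (e : direction R d.+1) : exists x, \val K x /\ x.2 = e.
Proof.
have [_ _ /seteqP[_ /(_ e I)[x Kx xe]]] := KspaceP K.
by exists x.
Qed.

Lemma compact_unit_cube : compact C.
Proof.
have := @rV_compact R d.+1 (fun=> `[0, 1]%classic) (fun=> @segment_compact R _ _).
congr compact; apply/seteqP; split=> x h i; have := h i; rewrite /= in_itv/=; exact.
Qed.

Lemma compact_unit_cubeX : compact (C `*` [set: direction R d.+1]).
Proof. by apply: compact_setX; [exact: compact_unit_cube|exact: compact_directions]. Qed.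

Lemma ball_Kdist K (r : R) : ball K r = [set L | Kdist K L < r].
Proof. by rewrite ballEmdist. Qed.

Lemma Kdistxx K : Kdist K K = 0.
Proof. exact: hausdorff_distxx. Qed.

Lemma open_KspaceP (O : set KS) K : open O -> O K ->
  exists2 r : R, 0 < r & forall L, Kdist K L < r -> O L.
Proof.
move=> oO OK; have /nbhs_ballP[r /= r0 rO] := open_nbhs_nbhs (conj oO OK).
by exists r => // L KL; apply: rO; rewrite ball_Kdist.
Qed.

Section limit.
Variables (Ks : nat -> KS) (r : nat -> R).
Hypothesis Ks_close : forall i j, (i <= j)%N -> Kdist (Ks i) (Ks j) < r i.

Let limit_set : set X := [set x | C x.1 /\
  forall j, exists2 z, \val (Ks j) z & pdist x z <= r j].

Let cluster_point (x : nat -> X) i0 (Z : set X) : closed Z ->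
  (forall i, (i0 <= i)%N -> \val (Ks i) (x i)) ->
  (forall i, (i0 <= i)%N -> Z (x i)) -> exists2 y, limit_set y & Z y.
Proof.
move=> cZ xK xZ.
have xC : \forall i \near \oo, (C `*` [set: direction R d.+1]) (x i).
  exists i0 => // i /= ii0; have [KC _ _] := KspaceP (Ks i).
  by apply: KC; exact: xK.
have [y [[Cy _] cy]] := compact_unit_cubeX (fmap_proper_filter x eventually_filter) xC.
have inA (A : set X) : closed A -> (\forall i \near \oo, A (x i)) -> A y.
  by move=> cA xA; apply: cA => B By; exact: cy xA By.
exists y; last by apply: inA => //; exists i0.
split=> // j; apply: (inA [set w | exists2 z, \val (Ks j) z & pdist w z <= r j]).
  by apply: closed_compact_nbhd; have [] := KspaceP (Ks j).
exists (maxn i0 j) => // i /=; rewrite geq_max => /andP[/xK xi /Ks_close].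
move=> /Kdist_lt[s [_ sr _ /(_ _ xi)[z zj zx]]]; exists z => //.
by rewrite pdist_sym (le_trans zx)// ltW.
Qed.

(** Any accumulation point of a sequence of points of the Ks i lies in the limit set,
    by compactness.  Applied to constant directions this shows that all
    directions occur, and applied to a sequence close to a point of Ks j it
    shows that this point is close to the limit. *)
Lemma Kspace_limit : exists L, forall j, Kdist (Ks j) L <= r j.
Proof.
have cS : compact limit_set.
  have -> : limit_set = (C `*` [set: direction R d.+1]) `&`
      \bigcap_j [set w | exists2 z, \val (Ks j) z & pdist w z <= r j].
    apply/seteqP; split=> [x [Cx h]|x [[Cx _] h]]; first by split=> // j _; exact: h.
    by split=> // j; exact: h.
  apply: compact_closedI; first exact: compact_unit_cubeX.
  apply: closed_bigI => j _; apply: closed_compact_nbhd.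
  by have [] := KspaceP (Ks j).
have pS : snd @` limit_set = setT.
  apply/seteqP; split=> // e _.
  have /choice[x xP] i : exists x, \val (Ks i) x /\ x.2 = e.
    exact: Kspace_full.
  have [y Ly ye] := @cluster_point x 0%N _ (@closed_direction _ _ e)
    (fun i _ => (xP i).1) (fun i _ => (xP i).2).
  by exists y.
have LK : Kset C [set: direction R d.+1] limit_set.
  by split=> // x [Cx _]; split.
exists (SigSub (mem_set LK)) => j; apply: hausdorff_dist_le.
- by have := Ks_close (leqnn j); rewrite Kdistxx => /ltW.
- move=> x Kx.
  have /choice[w wP] i : exists w, (j <= i)%N -> \val (Ks i) w /\ pdist x w <= r j.
    have [ji|ij] := leqP j i; last by exists x.
    have [s [_ sr /(_ _ Kx)[w Kw xw] _]] := Kdist_lt (Ks_close ji).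
    by exists w => _; split=> //; rewrite (le_trans xw)// ltW.
  have cZ : closed [set w | pdist x w <= r j].
    have := @closed_compact_nbhd R d.+1 [set x] (r j) (@compact_set1 _ x).
    congr closed; apply/seteqP; split=> [v [_ -> h]|v h] /=; first by rewrite pdist_sym.
    by exists x; rewrite // pdist_sym.
  have [y Ly yx] := @cluster_point w j _ cZ (fun i h => (wP i h).1) (fun i h => (wP i h).2).
  by exists y.
- by move=> y [_ /(_ j)[z Kz yz]]; exists z; rewrite // pdist_sym.
Qed.

End limit.

(** The radii e / 2 below leave room for the non-strict inequalities of
    [Kspace_limit]; they need not tend to 0. *)
Lemma Kspace_baire (O : nat -> set KS) : (forall k, open (O k) /\ dense (O k)) ->
  dense (\bigcap_k O k).
Proof.
move=> hO W [K0 WK0] oW.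
have /choice[step stepP] (kp : nat * (KS * R)) : exists p' : KS * R, 0 < kp.2.2 ->
    0 < p'.2 /\ forall L, Kdist p'.1 L < 2 * p'.2 ->
      O kp.1 L /\ Kdist kp.2.1 L < kp.2.2.
  case: kp => k [K r] /=; have [r0|] := boolP (0 < r); last by exists (K, r).
  have oB : open (ball K r)^° by exact: open_interior.
  have neB : (ball K r)^° !=set0 by exists K; apply: nbhsx_ballx.
  have [K' [BK' OK']] := (hO k).2 _ neB oB.
  have [e e0 eO] := open_KspaceP (openI oB (hO k).1) (conj BK' OK').
  exists (K', e / 2) => _ /=; split; first by rewrite divr_gt0.
  move=> L; rewrite mulrC divfK// => /eO[BL OL]; split=> //.
  by have := interior_subset BL; rewrite ball_Kdist.
have [e0 e00 eW] := open_KspaceP oW WK0.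
pose f := fix f k := if k is k'.+1 then step (k', f k') else (K0, e0 / 2).
have f0 k : 0 < (f k).2.
  elim: k => [|k IH]; first by rewrite /= divr_gt0.
  by have [] := stepP (k, f k) IH.
have fS k L : Kdist (f k.+1).1 L < 2 * (f k.+1).2 -> O k L /\ Kdist (f k).1 L < (f k).2.
  by have [_] := stepP (k, f k) (f0 k); exact.
have fle i j L : (i <= j)%N -> Kdist (f j).1 L < 2 * (f j).2 -> Kdist (f i).1 L < 2 * (f i).2.
  move=> /subnK <-; elim: (j - i)%N => // p IH; rewrite addSn => /fS[_ h].
  by apply: IH; have := f0 (p + i)%N; lra.
have close i j : (i <= j)%N -> Kdist (f i).1 (f j).1 < (f i).2.
  rewrite leq_eqVlt => /predU1P[->|ij]; first by rewrite Kdistxx.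
  apply: (fS i _ _).2; apply: (fle _ j) => //.
  by rewrite Kdistxx mulr_gt0.
have [L LP] := @Kspace_limit (fun i => (f i).1) (fun i => (f i).2) close.
have Llt k : Kdist (f k).1 L < 2 * (f k).2.
  by rewrite (le_lt_trans (LP k))//; have := f0 k; lra.
exists L; split; last by move=> k _; exact: (fS k L (Llt k.+1)).1.
by apply: eW; have := Llt 0%N; rewrite /= mulrC divfK.
Qed.

End KspaceBaire.

(** * Generic compact sets *)

Section Translate.
Context {R : realType} {k : nat}.
Local Notation V := 'rV[R]_k.
Implicit Types (F : nat -> seq (V * R)) (v : V).

Definition translate v F (l : nat) := [seq (b.1 + v, b.2) | b <- F l].

Lemma economical_translate u (e : R) v F :
  economical u e F -> economical u e (translate v F).
Proof.
move=> [F0 Fe]; split=> [l _ /mapP[b bl ->]|L]; first exact: F0 bl.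
apply: le_trans (Fe L); rewrite le_eqVlt; apply/orP; left; apply/eqP.
by apply: eq_bigr => l _; rewrite /weight big_map.
Qed.

Lemma covered_translate v F x : covered F x -> covered (translate v F) (x + v).
Proof.
move=> [l [b bl xb]]; exists l, (b.1 + v, b.2); first exact: map_f bl.
by rewrite /= opprD addrACA subrr addr0.
Qed.

End Translate.

Section Stages.
Context {R : realType} {d : nat}.
Local Notation W := 'rV[R]_d.+1.
Local Notation X := (W * direction R d.+1)%type.
Local Notation C := (@unit_cube R d.+1).
Local Notation KS := (Kspace C [set: direction R d.+1]).
Implicit Types (K L : KS) (x y z : X) (sigma : R).

(** Typical K belong to all stages.  Segments of growing length are used so that
    the union over k recovers the lines. *)
Definition stage sigma (k : nat) : set KS := [set K |
  exists2 F, economical sigma (2 ^- k) F & segments k%:R%:E (\val K) `<=` covered F].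

Lemma open_stage sigma k : open (stage sigma k).
Proof.
rewrite openE => K [F Fe KF]; rewrite /interior; apply/nbhs_ballP.
have [_ cK _] := KspaceP K.
have [|x Kx z xz|del del0 tube] := @segment_tube R d.+1 (\val K) (covered F) k%:R _ cK (@open_covered _ _ F).
- by [].
- by apply: KF; exists x.
exists del => // L; rewrite ball_Kdist => /Kdist_lt[s [_ sdel _ LK]].
exists F => // z [y /LK[x Kx xy] yz].
by apply: (tube x y) yz => //; exact: le_lt_trans sdel.
Qed.

Lemma segment_le (p : W) e (l l' : R) : l <= l' -> segment p e l%:E `<=` segment p e l'%:E.
Proof.
move=> ll' x [xe]; rewrite -EFinM lee_fin => xl; split=> //.
by rewrite -EFinM lee_fin (le_trans xl)// ler_pM2r// invr_gt0.
Qed.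

Lemma segment_translate (p q z : W) e (l : \bar R) : segment (q + p) e l z ->
  segment p e l (z - q).
Proof. by rewrite /segment /= opprD addrA. Qed.

(** K0 is approximated by a finite union of cells {p} x A, with A a closed set of
    directions near a member y of a finite net of K0, and p the point y.1 moved
    first towards the centre of the cube, to have room, and then by the small
    vector that puts the segments into the translate of the good open set.  The
    length k + 1 is used because the hypothesis concerns positive lengths. *)
Lemma dense_stage sigma k :
  (forall eta rho L : R, 0 < eta -> 0 < rho -> 0 < L ->
    exists2 F, economical sigma eta F & forall e : direction R d.+1,
      exists2 p, `|p| < rho & segment p e L%:E `<=` covered F) ->
  dense (stage sigma k).
Proof.
move=> good O [K0 OK0] oO.
have [r r0 rO] := open_KspaceP oO OK0.
have [K0C cK0 _] := KspaceP K0.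
pose del := r / 3; have del0 : 0 < del by rewrite divr_gt0.
pose c0 : R := Num.sqrt d.+1%:R + 1.
have c00 : 0 < c0 by rewrite ltr_wpDl ?sqrtr_ge0.
pose kap := Num.min 1 (del / c0).
have kap0 : 0 < kap by rewrite lt_min ltr01 divr_gt0.
have kap1 : kap <= 1 by rewrite ge_min lexx.
have kapc : c0 * kap <= del by rewrite mulrC -ler_pdivlMr// ge_min lexx orbT.
have [s [sK0 snet]] := @compact_finite_net _ (\val K0) (fun y => [set x | pdist y x < del]) cK0
  (fun y _ => pdist_small y del0).
pose N := size s.
have eta0 : 0 < 2 ^- k / N.+1%:R :> R by rewrite divr_gt0// invr_gt0 exprn_gt0.
have kap2 : 0 < kap / 2 by rewrite divr_gt0.
have [F Fe Fline] := good _ _ _ eta0 kap2 (ltr0Sn R k).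
have /choice[P PP] e : exists p, `|p| < kap / 2 /\ segment p e k.+1%:R%:E `<=` covered F.
  by have [p ? ?] := Fline e; exists p.
have /choice[D DP] e : exists del : R, 0 < del /\ forall f, angle e f < del ->
    segment (P e) f k.+1%:R%:E `<=` covered F.
  have [|_ ->|dl dl0 tube] := @segment_tube R d.+1 [set (P e, e)] (covered F) k.+1%:R _ (@compact_set1 _ _)
    (@open_covered _ _ F).
  - by [].
  - exact: (PP e).2.
  exists dl; split=> // f ef; apply: (tube (P e, e) (P e, f)) => //.
  by rewrite /pdist/= edistxx gt_max dl0.
have [G [_ Gnet]] := @compact_finite_net _ _ (fun e => [set f | angle e f < D e / 2])
  (@compact_directions R d) (fun e _ => angle_small e (ltac:(by have [? _] := DP e; rewrite divr_gt0) : 0 < D e / 2)).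
pose cc : W := \row_i (1 / 2).
pose ctr (y : X) := y.1 + kap *: (cc - y.1).
have cube_half (w : W) : C w -> `|cc - w| <= 1 / 2.
  move=> Cw; apply: norm_le_coord => // i; rewrite !mxE.
  have /andP[] := Cw i; clear - d; rewrite ler_norml => ? ?.
  by apply/andP; split; lra.
pose cell (y : X) (g : direction R d.+1) : set X :=
  [set ctr y + P g] `*` ([set f | angle g f <= D g / 2] `&` [set f | angle y.2 f <= del]).
pose S : set X := \bigcup_(y in [set` s]) \bigcup_(g in [set` G]) cell y g.
have ctr_close y g : \val K0 y -> edist y.1 (ctr y + P g) < del.
  move=> /K0C[Cy _]; rewrite edist_sym (le_lt_trans (edist_le_norm _ _))//.
  apply: (@lt_le_trans _ _ (c0 * kap)) => //; rewrite ltr_pM2l//.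
  rewrite /ctr addrAC addrAC addrC addrA addKr.
  rewrite (le_lt_trans (ler_normD _ _))// normrZ gtr0_norm//.
  have : kap * `|cc - y.1| <= kap * (1 / 2) by rewrite ler_pM2l// cube_half.
  by have := (PP g).1; clear - d; lra.
have ctr_cube y g : \val K0 y -> C (ctr y + P g).
  move=> /K0C[Cy _] i; rewrite !mxE.
  have := le_lt_trans (coord_le_norm (P g) i) (PP g).1.
  rewrite ltr_norml => /andP[h1 h2]; have /andP[h3 h4] := Cy i.
  by move: h1 h2 h3 h4 kap0 kap1; clear - d => *; apply/andP; split; nra.
have cS : compact S.
  rewrite /S bigcup_seq; apply: bigsetU_compact => y _.
  rewrite bigcup_seq; apply: bigsetU_compact => g _.
  apply: compact_setX; first exact: compact_set1.
  apply: subclosed_compact (@compact_directions R d) _ => //.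
  by apply: closedI; exact: closed_angle.
have pS : snd @` S = [set: direction R d.+1].
  apply/seteqP; split=> // f _; have [x [Kx xf]] := Kspace_full K0 f.
  have [y ys yx] := snet x Kx; have [g gG gf] := Gnet f I.
  exists (ctr y + P g, f) => //; exists y => //; exists g => //.
  split=> //; split=> /=; first exact: ltW.
  by move: yx; rewrite /= /pdist gt_max xf => /andP[_ /ltW].
have SK : Kset C [set: direction R d.+1] S.
  split=> // x [y ys [g gG [/= -> _]]]; split=> //.
  by apply: ctr_cube; exact: sK0.
pose L : KS := SigSub (mem_set SK).
exists L; split.
  apply: rO; apply: (@le_lt_trans _ _ (2 * del)); last by rewrite /del; move: r0; clear - d; lra.
  apply: hausdorff_dist_le; first by rewrite mulr_ge0 ?ltW.
    move=> x Kx; have [y ys yx] := snet x Kx; have [g gG gf] := Gnet x.2 I.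
    move: yx; rewrite /= /pdist gt_max => /andP[yx1 yx2].
    exists (ctr y + P g, x.2).
      exists y => //; exists g => //; split=> //; split=> /=; exact: ltW.
    rewrite ge_max anglexx (mulr_ge0 _ (ltW del0))// andbT.
    rewrite (le_trans (edist_triangle y.1 _ _))//.
    have := ctr_close y g (sK0 _ ys); rewrite edist_sym in yx1.
    by move: yx1; rewrite /=; clear - d; lra.
  move=> x [y ys [g gG [/= x1 [_ x2]]]]; exists y; first exact: sK0.
  rewrite /pdist ge_max x1; apply/andP; split.
    by have := ctr_close y g (sK0 _ ys); move: del0; clear - d; lra.
  by move: x2 del0; rewrite /=; clear - d; lra.
pose es i : R := if (i < N)%N then 2 ^- k / N.+1%:R else 0.
pose y0 : X := (0, chart_dir ord0 0).
pose Fs i := if (i < N)%N then translate (ctr (nth y0 s i)) F else fun=> [::].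
have Fse i : economical sigma (es i) (Fs i).
  rewrite /Fs /es; case: ifP => _; first exact: economical_translate.
  by split=> // M; rewrite big1// => l _; rewrite /weight big_nil.
have esL M : \sum_(i < M) es i <= 2 ^- k.
  apply: (@le_trans _ _ (\sum_(i < N) 2 ^- k / N.+1%:R)).
    have [MN|NM] := leqP M N.
      rewrite (big_ord_widen N es MN) big_mkcond/=; apply: ler_sum => i _.
      by rewrite /es ltn_ord; case: ifP => // _; exact: ltW.
    rewrite [leRHS](_ : _ = \sum_(i < N) es i); last by apply: eq_bigr => i _; rewrite /es ltn_ord.
    rewrite (big_ord_widen M es (ltnW NM)) [leRHS]big_mkcond/=; apply: ler_sum => i _.
    by rewrite /es; case: ifP.
  rewrite sumr_const card_ord -[leLHS]mulr_natr mulrAC ler_pdivrMr//.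
  by rewrite ler_pM2l ?invr_gt0 ?exprn_gt0// ler_nat leqnSn.
have [F' F'e FsF'] := economical_bigcup Fse esL.
exists F' => // z [x [y ys [g gG [/= x1 [x2 _]]]]].
rewrite x1 => /(segment_le (ltac:(by rewrite ler_nat) : k%:R <= k.+1%:R)) /segment_translate zs.
apply: (FsF' (index y s)); rewrite /Fs index_mem ys nth_index//.
rewrite -(subrK (ctr y) z); apply: covered_translate.
apply: (DP g).2 zs; apply: (le_lt_trans x2).
by have [+ _] := DP g; clear - d; lra.
Qed.

End Stages.

(** * The critical dimension *)

Section Critical.
Context {R : realType} {d : nat}.
Local Notation W := 'rV[R]_d.+1.
Local Notation KS := (Kspace (@unit_cube R d.+1) [set: direction R d.+1]).

(** The exponents which a test pair (D, E) shows to be typical upper bounds for the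
    dimension of the union of lines. *)
Definition achievable : set R := [set sigma |
  exists (D : set (direction R d.+1)) (E : set W) (u s : R),
    [/\ thick u D, 0 < s, null s E, segment_in_directions D E &
        d%:R - u < sigma - s]].

Lemma achievable_gt0 sigma : achievable sigma -> 0 < sigma.
Proof. by move=> [D [E [u [s [/(thick_le) ud s0 _ _]]]]]; lra. Qed.

Lemma achievable_lbound : has_lbound achievable.
Proof. by exists 0 => sigma /achievable_gt0/ltW. Qed.

(** The unit cube, with all directions, is a test set. *)
Lemma achievable_nonempty : achievable !=set0.
Proof.
exists (d%:R + 4), setT, (@cube R d.+1 1 0 0), d%:R, (d%:R + 2); split.
- exact: thick_full.
- by rewrite ltr_wpDl.
- by apply: null_cube; rewrite -natr1; lra.
- move=> e _; exists (\row_i (1 / 2)), (1 / 2); split=> // x [_].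
  rewrite -EFinM lee_fin => xl i; rewrite mesh0 mxE.
  have := le_trans (coord_le_norm _ i) (le_trans (norm_le_enorm _) xl).
  by rewrite !mxE ler_norml => /andP[? ?]; apply/andP; split; lra.
- lra.
Qed.

Definition critical : R := inf achievable.

Lemma critical_le sigma : achievable sigma -> critical <= sigma.
Proof. by move=> h; apply: ge_inf => //; exact: achievable_lbound. Qed.

(** Any s > dim E and any sigma > s + d - u form an achievable pair; both are taken
    within the gap g. *)
Lemma critical_le_dim (D : set (direction R d.+1)) (E : set W) (u : R) :
  thick u D -> segment_in_directions D E ->
  (critical%:E <= dimH E + (d%:R - u)%:E)%E.
Proof.
move=> uD DE; have ud := thick_le uD; rewrite leNgt; apply/negP => lt.
have dim0 : (0 <= dimH E)%E.
  by apply: le_ereal_inf_tmp => _ [s [s0 _] <-]; rewrite lee_fin.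
case dE : (dimH E) dim0 lt => [w| |]//; rewrite lee_fin => w0.
rewrite -EFinD lte_fin => lt.
pose g := critical - (w + (d%:R - u)); have g0 : 0 < g by rewrite subr_gt0.
have : achievable (critical - g / 3); last by move/critical_le; lra.
exists D, E, u, (w + g / 3); split=> //.
- lra.
- by apply: null_of_dimH_lt; [lra|rewrite dE lte_fin; lra].
- by rewrite /g; lra.
Qed.

Lemma dimH_dir_ge0 (D : set (direction R d.+1)) : (0 <= dimH_dir D)%E.
Proof. by apply: le_ereal_inf_tmp => _ [s [s0 _] <-]; rewrite lee_fin. Qed.

Lemma dimH_dir_le (D : set (direction R d.+1)) : (dimH_dir D <= d%:R%:E)%E.
Proof.
rewrite leNgt; apply/negP => lt.
have [u du uD] : exists2 u : R, d%:R < u & (u%:E < dimH_dir D)%E.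
  case dD : (dimH_dir D) lt => [w| |]//.
    rewrite lte_fin => dw; exists ((d%:R + w) / 2); first lra.
    by rewrite lte_fin; lra.
  by move=> _; exists (d%:R + 1); [rewrite ltrDl|exact: ltry].
have u0 : 0 < u by exact: le_lt_trans du.
by have := thick_le (thick_of_dim u0 uD); rewrite leNgt du.
Qed.

(** Let u tend to dim D in [critical_le_dim].  If dim D = 0 there is no positive
    u below it, and u = 0 is used instead. *)
Lemma critical_bound (D : set (direction R d.+1)) (E : set W) :
  D !=set0 -> segment_in_directions D E ->
  (critical%:E - (d%:R%:E - dimH_dir D) <= dimH E)%E.
Proof.
move=> D0 DE; have := dimH_dir_ge0 D; have := dimH_dir_le D.
case dD : (dimH_dir D) => [v| |]//; rewrite !lee_fin => vd v0.
rewrite -!EFinB leNgt; apply/negP => lt.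
have h0 := critical_le_dim (thick0 D0) DE.
have dim0 : (0 <= dimH E)%E.
  by apply: le_ereal_inf_tmp => _ [s [s0 _] <-]; rewrite lee_fin.
case dE : (dimH E) dim0 lt h0 => [w| |]//; rewrite lee_fin lte_fin -EFinD lee_fin => w0 lt h0.
(* h0 settles the case v = 0. *)
have [vp|vn] := ltP 0 v; last by move: lt h0 vn; clear; lra.
pose g := critical - (d%:R - v) - w; have g0 : 0 < g by rewrite subr_gt0.
pose u := Num.max (v / 2) (v - g / 2).
have u0 : 0 < u by rewrite lt_max divr_gt0.
have uv : u < v by rewrite gt_max; apply/andP; split; lra.
have ug : v - g / 2 <= u by rewrite le_max lexx orbT.
have uD : thick u D by apply: thick_of_dim => //; rewrite dD lte_fin.
have := critical_le_dim uD DE; rewrite dE -EFinD lee_fin.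
by rewrite /g in g0 ug; lra.
Qed.

Lemma approx_critical : exists sg : nat -> R, forall k,
  achievable (sg k) /\ sg k < critical + k.+1%:R^-1.
Proof.
suff /choice[sg sgP] k : exists s, achievable s /\ s < critical + k.+1%:R^-1.
  by exists sg.
have k0 : 0 < k.+1%:R^-1 :> R by rewrite invr_gt0.
have hi : has_inf achievable by split; [exact: achievable_nonempty|exact: achievable_lbound].
have [s As sk] := inf_adherent k0 hi.
by exists s.
Qed.

(** For k large sg k <= sigma, and radii are at most 1, so that the cost in dimension
    sigma does not exceed the cost in dimension sg k. *)
Lemma null_lines (sg : nat -> R) (K : KS) (sigma : R) :
  (forall k, achievable (sg k) /\ sg k < critical + k.+1%:R^-1) ->
  (forall k, stage (sg k) k K) -> critical < sigma ->
  null sigma (segments +oo%E (\val K)).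
Proof.
move=> sgP KK csig.
apply: (@null_sub _ _ _ _ (\bigcup_k segments k%:R%:E (\val K))).
  move=> z [x Kx [xe _]]; exists (Num.truncn (2 * enorm (z - x.1))).+1 => //.
  exists x => //; split=> //; rewrite -EFinM lee_fin.
  have := truncnS_gt (2 * enorm (z - x.1)).
  by rewrite ler_pdivlMr// mulrC => /ltW.
apply: null_bigcup => k e e0.
pose k1 := Num.truncn ((sigma - critical)^-1).
have [k2 k2e] : exists k2, 2 ^- k2 < e :> R by apply: (@mesh_small R 1).
pose m := maxn k (maxn k1 k2).
have [F Fe KF] := KK m.
have sgm : sg m <= sigma.
  apply/ltW/(lt_trans (sgP m).2); rewrite -ltrBrDl invf_plt ?posrE ?subr_gt0//.
  rewrite (lt_le_trans (truncnS_gt _))// ler_nat ltnS.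
  by rewrite /m !leq_max leqnn !orbT.
have sg0 := achievable_gt0 (sgP m).1.
have me : 2 ^- m <= e.
  rewrite (le_trans _ (ltW k2e))// lef_pV2 ?posrE ?exprn_gt0//.
  by apply: ler_weXn2l; [rewrite ler1n|rewrite /m !leq_max leqnn !orbT].
exists F; last first.
  move=> z [x Kx xz]; apply: KF; exists x => //; apply: segment_le xz.
  by rewrite ler_nat /m leq_max leqnn.
split=> [l b|L]; first exact: Fe.1.
apply: (le_trans _ me); apply: le_trans (Fe.2 L); apply: ler_sum => l _.
rewrite /weight big_seq [leRHS]big_seq; apply: ler_sum => b bl.
apply: ger_powR => //; rewrite (Fe.1 _ _ bl)/=.
apply: (powR_le_inv sg0) => //; first exact/ltW/(Fe.1 _ _ bl).
rewrite powR1 (le_trans (economical_radius Fe bl))//.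
by rewrite invf_le1 ?exprn_gt0// exprn_ege1// ler1n.
Qed.

Lemma compact_segments1 (K : KS) : compact (segments 1%E (\val K)).
Proof.
have [KC cK _] := KspaceP K.
apply: bounded_closed_compact; last by apply: closed_segments => //; rewrite lee_fin.
exists 2; split; first exact: num_real.
move=> M M2 z [x /KC[Cx _] [_ xz]].
move: xz; rewrite -EFinM lee_fin mul1r => xz.
have x1 : `|x.1| <= 1.
  by apply: norm_le_coord => // i; have /andP[? ?] := Cx i; rewrite ger0_norm.
have h := ler_normD (z - x.1) x.1; rewrite subrK in h; apply: (le_trans h).
by have := le_trans (norm_le_enorm _) xz; lra.
Qed.

Lemma segments_sub (p : W) e l (K : KS) : \val K (p, e) ->
  segment p e l `<=` segments l (\val K).
Proof. by move=> Kp z pz; exists (p, e). Qed.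

Lemma generic_conclusion (sg : nat -> R) (K : KS) :
  (forall k, achievable (sg k) /\ sg k < critical + k.+1%:R^-1) ->
  (forall k, stage (sg k) k K) ->
  let B := segments 1%E (\val K) in
  let F := segments +oo%E (\val K) in
  [/\ compact B /\ besicovitch B,
      closed F /\ line_in_every_direction F,
      dimH B = dimH F &
      forall (E : set W) (D : set (direction R d.+1)),
        D !=set0 -> segment_in_directions D E ->
        (dimH B - ((d.+1%:R - 1)%:E - dimH_dir D) <= dimH E)%E].
Proof.
move=> sgP KK B F; have [_ cK _] := KspaceP K.
have Bes : besicovitch B.
  by move=> e; have [[p f] [Kp /= <-]] := Kspace_full K e; exists p; exact: segments_sub.
have Lin : line_in_every_direction F.
  by move=> e; have [[p f] [Kp /= <-]] := Kspace_full K e; exists p; exact: segments_sub.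
have crit_ge (A : set W) : segment_in_directions setT A -> (critical%:E <= dimH A)%E.
  move=> hA; have := critical_le_dim (@thick_full R d) hA.
  by rewrite subrr adde0.
have crit0 : 0 <= critical.
  by apply: lb_le_inf; [exact: achievable_nonempty|move=> s /achievable_gt0/ltW].
have dim_le (A : set W) : A `<=` F -> (dimH A <= critical%:E)%E.
  move=> AF; apply/lee_addgt0Pr => e e0; rewrite -EFinD.
  apply: dimH_le_of_null; first by lra.
  by apply: null_sub AF _; apply: (null_lines sgP KK); lra.
have BF : B `<=` F.
  move=> z [x Kx [xe _]]; exists x => //; split=> //.
  by rewrite gt0_mulye ?lte_fin ?invr_gt0// leey.
have dB : dimH B = critical%:E.
  apply/eqP; rewrite eq_le dim_le// crit_ge// => e _.
  by have [p pB] := Bes e; exists p, 1; split.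
have dF : dimH F = critical%:E.
  apply/eqP; rewrite eq_le dim_le// crit_ge// => e _.
  have [p pF] := Lin e; exists p, 1; split=> // z [ze _]; apply: pF; split=> //.
  by rewrite gt0_mulye ?lte_fin ?invr_gt0// leey.
split.
- by split=> //; exact: compact_segments1.
- by split=> //; apply: closed_segments.
- by rewrite dB dF.
- move=> E D D0 DE; rewrite dB -natr1 addrK.
  exact: critical_bound.
Qed.

End Critical.

Lemma Kset_full_fiber (R : realType) (d : nat) :
  Kset (@unit_cube R d.+1) [set: direction R d.+1]
    ([set 0] `*` [set: direction R d.+1]).
Proof.
split; last 2 first.
- by apply: compact_setX; [exact: compact_set1|exact: compact_directions].
- by apply/seteqP; split=> // e _; exists (0, e).
by move=> x [/= -> _]; split=> // i; rewrite mxE lexx ler01.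
Qed.

Theorem theorem1p4 (R : realType) (n : nat) (hn : (2 <= n)%N) :
  (exists B F : set 'rV[R]_n,
    [/\ compact B /\ besicovitch B,
        closed F /\ line_in_every_direction F,
        dimH B = dimH F &
        forall (E : set 'rV[R]_n) (D : set (direction R n)),
          D !=set0 -> segment_in_directions D E ->
          (dimH B - ((n%:R - 1)%:E - dimH_dir D) <= dimH E)%E])
  /\
  residual [set K : Kspace (@unit_cube R n) [set: direction R n] |
    let B := segments 1%E (\val K) in
    let F := segments +oo%E (\val K) in
    [/\ compact B /\ besicovitch B,
        closed F /\ line_in_every_direction F,
        dimH B = dimH F &
        forall (E : set 'rV[R]_n) (D : set (direction R n)),
          D !=set0 -> segment_in_directions D E ->
          (dimH B - ((n%:R - 1)%:E - dimH_dir D) <= dimH E)%E]].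
Proof.
case: n hn => [//|d]; rewrite ltnS => d0.
have [sg sgP] := @approx_critical R d.
have dns : dense (\bigcap_k @stage R d (sg k) k).
  apply: Kspace_baire => k; split; first exact: open_stage.
  have [[D [E [u [s [uD s0 nE DE us]]]]] _] := sgP k.
  by apply: dense_stage; exact: (thick_segments d0 uD s0 nE DE us).
have sub K : (\bigcap_k stage (sg k) k) K -> _ :=
  fun h => generic_conclusion sgP (fun k => h k I).
split; last first.
  exists (\bigcap_k stage (sg k) k); split=> //.
  by exists (fun k => stage (sg k) k) => // k; exact: open_stage.
have [|K [_ /sub KP]] := dns setT _ openT.
  by exists (SigSub (mem_set (Kset_full_fiber R d))).
exists (segments 1%E (\val K)), (segments +oo%E (\val K)); exact: KP.
Qed.
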